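(* There is a polynomial-time algorithm for the SBFE problem for monotone $k$-term DNF formulas that, given a monotone DNF formula $f$ with at most $k$ terms on variables $x_1,\ldots,x_n$, a probability vector $p$ and a cost vector $c$, computes a testing strategy whose expected cost (with respect to $D_p$) is at most $\max\{2k, \frac{2}{\rho}(1+\ln k)\}\cdot E[CERT(f,x)]$, where $\rho = \min_i \min\{p_i,1-p_i\}$. (The running time is polynomial in the input size, with no exponential dependence on $k$.)
   Context: SBFE problem: given a formula for $f(x_1,\ldots,x_n)$, probabilities $p=(p_1,\ldots,p_n)$ with $0<p_i<1$ and costs $c=(c_1,\ldots,c_n)$ with $c_i\ge 0$, an unknown $x\in\{0,1\}^n$ is drawn from the product distribution $D_p$ ($\Pr[x_i=1]=p_i$ independently); the value of $x_i$ is learned only by testing it at cost $c_i$; tests are performed sequentially and adaptively until $f(x)$ is determined, and the goal is to minimize expected total cost. Running time means the worst-case time to choose the next test or output the value. A monotone $k$-term DNF is a disjunction of at most $k$ terms, each a conjunction of unnegated variables. A partial assignment $b\in\{0,1,*\}^n$ is a 0-certificate (1-certificate) of $f$ if $f(a)=0$ ($f(a)=1$) for all $a$ agreeing with $b$ on its non-$*$ positions; its cost is $\sum_{j: b_j\neq *} c_j$; $x$ contains $b$ if $x_i=b_i$ for all $b_i\ne *$. $CERT(f,x)$ is the minimum cost of a certificate of $f$ contained in $x$, and $E[CERT(f,x)]$ is its expectation for $x\sim D_p$. *)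

(* Defs.v *)
From mathcomp Require Import all_boot all_order all_algebra.
From mathcomp Require Import reals exp.

Set Implicit Arguments.
Unset Strict Implicit.
Unset Printing Implicit Defensive.

Import Order.TTheory GRing.Theory Num.Theory.

(** * Machine model

  Running time is measured on a first-order functional language over binary
  trees whose leaves are natural numbers written in binary.  Every evaluation
  step costs one unit, and an arithmetic operation is charged in addition for
  the bits it reads (schoolbook bound for the product), that is, according to
  the logarithmic cost criterion.  Trees are passed by reference: no
  operation copies, traverses or compares a tree.  A computation of cost [t]
  is therefore simulated by a Turing machine in time polynomial in [t] and in
  the size of its input, and conversely. *)

Inductive val := Leaf of nat | Node of val & val.

Definition bitlen (m : nat) : nat := (trunc_log 2 m).+1.

Fixpoint vsize (v : val) : nat :=
  match v with
  | Leaf m => bitlen m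
  | Node u w => (vsize u + vsize w).+1
  end.

Inductive arith := Add | Sub | Mul | Leq.

Definition arith_sem (o : arith) (a b : nat) : nat :=
  match o with
  | Add => a + b
  | Sub => a - b
  | Mul => a * b
  | Leq => a <= b
  end.

Definition arith_cost (o : arith) (a b : nat) : nat :=
  if o is Mul then bitlen a * bitlen b else bitlen a + bitlen b.

(* Variables are de Bruijn indices.  Functions take a single argument, which
   is the whole environment of their body. *)
Inductive expr :=
| EVar of nat
| ENum of nat
| EArith of arith & expr & expr
| EPair of expr & expr
| EFst of expr
| ESnd of expr
| EIsNum of expr
| EIf of expr & expr & expr
| ELet of expr & expr
| ECall of nat & expr.

(* The list of the bodies of the (mutually recursive) functions; function 0 is
   the entry point. *)
Definition program := seq expr.

Definition body (P : program) (g : nat) : expr := nth (ENum 0) P g.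

(* [eval P env e v t]: in the program [P] and the environment [env], [e]
   evaluates to [v] at cost [t].  Nonzero numbers are true. *)
Inductive eval (P : program) : seq val -> expr -> val -> nat -> Prop :=
| EvVar env i : eval P env (EVar i) (nth (Leaf 0) env i) 1
| EvNum env m : eval P env (ENum m) (Leaf m) 1
| EvArith env o e1 e2 a b t1 t2 :
    eval P env e1 (Leaf a) t1 -> eval P env e2 (Leaf b) t2 ->
    eval P env (EArith o e1 e2) (Leaf (arith_sem o a b))
         (t1 + t2 + arith_cost o a b).+1
| EvPair env e1 e2 v1 v2 t1 t2 :
    eval P env e1 v1 t1 -> eval P env e2 v2 t2 ->
    eval P env (EPair e1 e2) (Node v1 v2) (t1 + t2).+1
| EvFst env e v1 v2 t :
    eval P env e (Node v1 v2) t -> eval P env (EFst e) v1 t.+1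
| EvSnd env e v1 v2 t :
    eval P env e (Node v1 v2) t -> eval P env (ESnd e) v2 t.+1
| EvIsNum env e v t :
    eval P env e v t ->
    eval P env (EIsNum e) (Leaf (if v is Leaf _ then 1 else 0)) t.+1
| EvIf env e e1 e2 m v t t' :
    eval P env e (Leaf m) t -> eval P env (if m == 0 then e2 else e1) v t' ->
    eval P env (EIf e e1 e2) v (t + t').+1
| EvLet env e1 e2 v1 v2 t1 t2 :
    eval P env e1 v1 t1 -> eval P (v1 :: env) e2 v2 t2 ->
    eval P env (ELet e1 e2) v2 (t1 + t2).+1
| EvCall env g e v w t t' :
    eval P env e v t -> eval P [:: v] (body P g) w t' ->
    eval P env (ECall g e) w (t + t').+1.

Definition runs (P : program) (v w : val) (t : nat) : Prop :=
  eval P [:: v] (body P 0) w t.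

Lemma eval_det P env e v t :
  eval P env e v t -> forall v' t', eval P env e v' t' -> v = v' /\ t = t'.
Proof.
elim=> {env e v t}; intros;
  match goal with H : eval _ _ _ ?v' ?t' |- _ = ?v' /\ _ = ?t' =>
    inversion H; subst end;
  repeat match goal with
  | IH : forall v' t', eval P ?env ?e v' t' -> _, H : eval P ?env ?e _ _ |- _ =>
      case: (IH _ _ H) => ? ?; clear IH;
      repeat match goal with
      | E : Leaf _ = Leaf _ |- _ => case: E => ?
      | E : Node _ _ = Node _ _ |- _ => case: E => ? ?
      end; subst
  end; by [].
Qed.

(** * Formulas and certificates *)

Section SBFE.

Variable n : nat.

Definition assignment := {ffun 'I_n -> bool}.

(* A term is the list of the (unnegated) variables it conjoins. *)
Definition mdnf := seq (seq 'I_n).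

Definition eval_mdnf (f : mdnf) (x : assignment) : bool :=
  has (fun t : seq 'I_n => all x t) f.

(* [None] is the value [*]. *)
Definition partial_assignment := {ffun 'I_n -> option bool}.

Definition contains (x : assignment) (b : partial_assignment) : bool :=
  [forall i, (b i != None) ==> (b i == Some (x i))].

Definition is_cert (f : mdnf) (v : bool) (b : partial_assignment) : bool :=
  [forall x : assignment, contains x b ==> (eval_mdnf f x == v)].

Local Open Scope ring_scope.

Definition cert_cost (c : 'I_n -> rat) (b : partial_assignment) : rat :=
  \sum_(i < n | b i != None) c i.

(* The minimum is over a nonempty set, as [x] itself is a certificate. *)
Definition CERT (c : 'I_n -> rat) (f : mdnf) (x : assignment) : rat :=
  cert_cost c
    [arg min_(b < [ffun i => Some (x i)]
                | (is_cert f false b || is_cert f true b) && contains x b)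
       cert_cost c b]%O.

(** * Product distribution *)

Definition prD (p : 'I_n -> rat) (x : assignment) : rat :=
  \prod_(i < n) (if x i then p i else 1 - p i).

Definition expectation (p : 'I_n -> rat) (F : assignment -> rat) : rat :=
  \sum_(x : assignment) prD p x * F x.

(* The default value 1 exceeds every term and only matters when [n = 0]. *)
Definition rho (p : 'I_n -> rat) : rat :=
  \big[Num.min/1]_(i < n) Num.min (p i) (1 - p i).

(** * Testing strategies *)

(* The tests performed so far with their outcomes, in chronological order. *)
Definition history := seq ('I_n * bool).

Inductive action := Test of 'I_n | Output of bool.

Definition strategy := history -> action.

(* The history after (at most) [m] tests, when the unknown assignment is [x]. *)
Fixpoint hist (S : strategy) (x : assignment) (m : nat) : history :=
  if m is m'.+1 then
    let h := hist S x m' in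
    if S h is Test i then rcons h (i, x i) else h
  else [::].

Definition known (h : history) : partial_assignment :=
  [ffun i => if (i, true) \in h then Some true
             else if (i, false) \in h then Some false else None].

(* On every reachable history, [S] outputs the value of [f] if the outcomes
   determine it, and otherwise tests a variable that has not been tested. *)
Definition evaluates (S : strategy) (f : mdnf) : Prop :=
  forall (x : assignment) (m : nat), let h := hist S x m in
  match S h with
  | Test i => (i \notin unzip1 h) &&
              ~~ (is_cert f false (known h) || is_cert f true (known h))
  | Output v => is_cert f v (known h)
  end.

(* When [S] evaluates a formula, it stops after at most [n] tests. *)
Definition test_cost (c : 'I_n -> rat) (S : strategy) (x : assignment) : rat :=
  \sum_(a <- hist S x n) c a.1.

(** * Encodings *)

Fixpoint enc_list (s : seq val) : val :=
  if s is v :: s' then Node v (enc_list s') else Leaf 0.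

Definition enc_bool (b : bool) : val := Leaf (nat_of_bool b).

Definition enc_var (i : 'I_n) : val := Leaf (nat_of_ord i).

(* Numerator and denominator; the sign is lost, but only nonnegative rationals
   are encoded. *)
Definition enc_rat (r : rat) : val := Node (Leaf `|numq r|%N) (Leaf `|denq r|%N).

Definition enc_vector (u : 'I_n -> rat) : val :=
  enc_list [seq enc_rat (u i) | i <- enum 'I_n].

Definition enc_instance (f : mdnf) (p c : 'I_n -> rat) : val :=
  Node (enc_list [seq enc_list [seq enc_var i | i <- t] | t <- f])
       (Node (enc_vector p) (enc_vector c)).

Definition enc_history (h : history) : val :=
  enc_list [seq Node (enc_var a.1) (enc_bool a.2) | a <- h].

Definition enc_action (a : action) : val :=
  match a with
  | Test i => Node (Leaf 0) (enc_var i)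
  | Output v => Node (Leaf 1) (enc_bool v)
  end.

(* Given the instance and a reachable history, [P] computes the next action of
   [S] within time [T], where [T] does not depend on the history. *)
Definition computes_strategy (P : program) (f : mdnf) (p c : 'I_n -> rat)
    (S : strategy) (T : nat) : Prop :=
  forall (x : assignment) (m : nat), let h := hist S x m in
  exists2 t : nat, (t <= T)%N &
    runs P (Node (enc_instance f p c) (enc_history h)) (enc_action (S h)) t.

End SBFE.

(* Main.v *)
(* Clearing denominators turns the costs into integers.  The strategy stops as
   soon as the value is determined; otherwise it interleaves two searches.
   - The term search tests the cheapest term not yet completely tested.  If
     [f x = 1] and [t] is the cheapest satisfied term, it only ever works on
     terms of cost at most that of [t], which is at most CERT.
   - The greedy search simulates a greedy algorithm that sees only its own
     tests: it tests the variable minimizing cost per not yet falsified term.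
     Before its next test, for which its own total would become [B], every
     term of cost at most [B / size f] is completely tested.
   So if [f x = 1] the cost is at most [2 k CERT], and if [f x = 0] it is at
   most twice that of the greedy search.  In the latter case the tests with
   outcome 0 cost at most [H_k CERT] by the potential argument for greedy set
   cover.  Given [f x = 0] and that the greedy search tests [i], [x i = 0] has
   probability at least [1 - p i >= rho], so in expectation all the tests of the
   greedy search cost at most [1 / rho] times those with outcome 0. *)

Require Import Defs.
From mathcomp Require Import all_boot all_order all_algebra.
From mathcomp Require Import reals exp.
From mathcomp Require Import zify ring lra.
Import Order.TTheory GRing.Theory Num.Theory.

Set Implicit Arguments.
Unset Strict Implicit.
Unset Printing Implicit Defensive.

(** * The strategy *)

Section Strategy.

Variables (n : nat) (f : mdnf n) (C : 'I_n -> nat).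

(* 0 and 1 are the outcomes, 2 means untested. *)
Definition look (h : history n) (i : 'I_n) : nat :=
  foldl (fun r (a : 'I_n * bool) => if a.1 == i then nat_of_bool a.2 else r) 2 h.

Definition falsified (h : history n) (t : seq 'I_n) : bool :=
  has (fun i => look h i == 0) t.

(** The result serves twice: as a variable to test and, coerced to a boolean, as the claim that the
    term is not completely tested. *)
Definition untested (h : history n) (t : seq 'I_n) : option 'I_n :=
  foldl (fun r i => if look h i == 2 then Some i else r) None t.

Definition satisfied (h : history n) (t : seq 'I_n) : bool :=
  ~~ falsified h t && ~~ untested h t.

Definition term_cost (t : seq 'I_n) : nat :=
  \sum_(i <- enum 'I_n | i \in t) C i.

(** Minimizes the quotient of [a] by [b]. Cross multiplication keeps the comparison in integer
    arithmetic, which the program can imitate. *)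
Definition ratio_min (T : Type) (ok : pred T) (a b : T -> nat) (s : seq T) :
    option T :=
  foldl (fun r x => if ok x then
                      if r is Some y then
                        if a y * b x <= a x * b y then r else Some x
                      else Some x
                    else r) None s.

(** Falsified terms stay eligible while they contain an untested variable. *)
Definition cheapest (h : history n) : option (seq 'I_n) :=
  ratio_min (fun t => untested h t : bool) term_cost (fun=> 1) f.

Definition count_open (h : history n) (i : 'I_n) : nat :=
  count (fun t : seq 'I_n => (i \in t) && ~~ falsified h t) f.

Definition greedy (h : history n) : option 'I_n :=
  ratio_min (fun i => (look h i == 2) && (0 < count_open h i)) C (count_open h)
    (enum 'I_n).

(* [kc] is [size f] times the cost of the cheapest incompletely tested term and
   [i1] an untested variable of that term.  The state is the chosen test, or
   the tests of the simulated greedy search together with their cost. *)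
Definition search_step (h : history n) (kc : nat) (i1 : 'I_n)
    (s : 'I_n + history n * nat) : 'I_n + history n * nat :=
  match s with
  | inl _ => s
  | inr (h0, K) =>
      if greedy h0 is Some g then
        if kc <= K + C g then inl i1
        else if look h g == 2 then inl g
        else inr ((g, look h g == 1) :: h0, K + C g)
      else s
  end.

(** The simulation restarts from the empty history at every call, so the strategy needs no memory
    beyond the history. *)
Definition search (h : history n) (kc : nat) (i1 : 'I_n) (m : nat) :=
  iter m (search_step h kc i1) (inr ([::], 0)).

Definition next_test (h : history n) : option 'I_n :=
  if cheapest h is Some t then
    if untested h t is Some i1 then
      if search h (size f * term_cost t) i1 n is inl i then Some i else None
    else None
  else None.

Definition strat (h : history n) : action n :=
  if has (satisfied h) f then Output n true
  else if has (fun t => ~~ falsified h t) f then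
    if next_test h is Some i then Test i else Output n false
  else Output n false.

End Strategy.

(** * The program *)

(** [Leq] is the only comparison of the machine, so both operands may be evaluated twice. *)
Definition EEq (e1 e2 : expr) : expr :=
  EIf (EArith Leq e1 e2) (EArith Leq e2 e1) (ENum 0).

(* Left fold, called with [Node l (Node acc ctx)]; [step] computes the new
   accumulator in the environment [:: x; acc; ctx; ...]. *)
Definition loop (g : nat) (step : expr) : expr :=
  EIf (EIsNum (EFst (EVar 0))) (EFst (ESnd (EVar 0)))
    (ECall g (EPair (ESnd (EFst (EVar 0)))
       (EPair (ELet (ESnd (ESnd (EVar 0)))
                (ELet (EFst (ESnd (EVar 1)))
                  (ELet (EFst (EFst (EVar 2))) step)))
              (ESnd (ESnd (EVar 0)))))).

Definition call_loop (g : nat) (l acc ctx : expr) : expr :=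
  ECall g (EPair l (EPair acc ctx)).

Definition mem_id := 1.
Definition look_id := 2.
Definition fals_id := 3.
Definition unt_id := 4.
Definition tcost_id := 5.
Definition cheap_id := 6.
Definition sat_id := 7.
Definition open_id := 8.
Definition count_id := 9.
Definition greedy_id := 10.
Definition size_id := 11.
Definition search_id := 12.
Definition scale_id := 13.

Definition mem_step := EIf (EEq (EVar 0) (EVar 2)) (ENum 1) (EVar 1).

Definition look_step :=
  EIf (EEq (EFst (EVar 0)) (EVar 2)) (ESnd (EVar 0)) (EVar 1).

Definition fals_step :=
  EIf (call_loop look_id (EVar 2) (ENum 2) (EVar 0)) (EVar 1) (ENum 1).

Definition unt_step :=
  EIf (EEq (call_loop look_id (EVar 2) (ENum 2) (EVar 0)) (ENum 2))
    (EPair (ENum 0) (EVar 0)) (EVar 1).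

(** The list of costs does not name its variables, so the accumulator pairs a position counter with
    the running sum. *)
Definition tcost_step :=
  EPair (EArith Add (EFst (EVar 1)) (ENum 1))
    (EIf (call_loop mem_id (EVar 2) (ENum 0) (EFst (EVar 1)))
       (EArith Add (ESnd (EVar 1)) (EVar 0)) (ESnd (EVar 1))).

(** In place of the best term, the accumulator keeps one of its untested variables, as an encoded
    test, and the cost of the term: the later search needs no more. *)
Definition cheap_step :=
  ELet (call_loop unt_id (EVar 0) (ENum 0) (EFst (EVar 2)))
    (EIf (EIsNum (EVar 0)) (EVar 2)
       (ELet (ESnd (call_loop tcost_id (ESnd (EVar 3))
                      (EPair (ENum 0) (ENum 0)) (EVar 1)))
          (EIf (EIsNum (EVar 3)) (EPair (EVar 1) (EVar 0))
             (EIf (EArith Leq (ESnd (EVar 3)) (EVar 0)) (EVar 3)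
                (EPair (EVar 1) (EVar 0)))))).

Definition sat_step :=
  EIf (call_loop fals_id (EVar 0) (ENum 0) (EVar 2)) (EVar 1)
    (EIf (EIsNum (call_loop unt_id (EVar 0) (ENum 0) (EVar 2))) (ENum 1)
       (EVar 1)).

Definition open_step :=
  EIf (call_loop fals_id (EVar 0) (ENum 0) (EVar 2)) (EVar 1) (ENum 1).

Definition count_step :=
  EIf (call_loop mem_id (EVar 0) (ENum 0) (EFst (EVar 2)))
    (EIf (call_loop fals_id (EVar 0) (ENum 0) (ESnd (EVar 2))) (EVar 1)
       (EArith Add (EVar 1) (ENum 1)))
    (EVar 1).

(** Again a position counter comes first. The best candidate carries its cost and count, ready for
    the next comparison. *)
Definition greedy_step :=
  EPair (EArith Add (EFst (EVar 1)) (ENum 1))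
    (EIf (EEq (call_loop look_id (ESnd (EVar 2)) (ENum 2) (EFst (EVar 1)))
              (ENum 2))
       (ELet (call_loop count_id (EFst (EVar 2)) (ENum 0)
                (EPair (EFst (EVar 1)) (ESnd (EVar 2))))
          (EIf (EVar 0)
             (ELet (EPair (EFst (EVar 2)) (EPair (EVar 1) (EVar 0)))
                (EIf (EIsNum (ESnd (EVar 3))) (EVar 0)
                   (EIf (EArith Leq
                           (EArith Mul (EFst (ESnd (ESnd (EVar 3)))) (EVar 1))
                           (EArith Mul (EVar 2) (ESnd (ESnd (ESnd (EVar 3))))))
                      (ESnd (EVar 3)) (EVar 0))))
             (ESnd (EVar 2))))
       (ESnd (EVar 1))).

Definition size_step := EArith Add (EVar 1) (ENum 1).

(* The context is [(f, (h, (costs, (kc, i1))))]; the accumulator is the next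
   test, as an encoded action, or [Node (Leaf 1) (Node h0 K)]. *)
Definition search_step_expr :=
  EIf (EFst (EVar 1))
    (ELet (ESnd (call_loop greedy_id (EFst (ESnd (ESnd (EVar 2))))
                   (EPair (ENum 0) (ENum 0))
                   (EPair (EFst (EVar 2)) (EFst (ESnd (EVar 1))))))
       (EIf (EIsNum (EVar 0)) (EVar 2)
          (ELet (EArith Add (ESnd (ESnd (EVar 2))) (EFst (ESnd (EVar 0))))
             (EIf (EArith Leq (EFst (ESnd (ESnd (ESnd (EVar 4))))) (EVar 0))
                (ESnd (ESnd (ESnd (ESnd (EVar 4)))))
                (ELet (call_loop look_id (EFst (ESnd (EVar 4))) (ENum 2)
                         (EFst (EVar 1)))
                   (EIf (EEq (EVar 0) (ENum 2))
                      (EPair (ENum 0) (EFst (EVar 2)))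
                      (EPair (ENum 1)
                         (EPair (EPair (EPair (EFst (EVar 2)) (EVar 0))
                                   (EFst (ESnd (EVar 4))))
                            (EVar 1)))))))))
    (EVar 1).

(* Called with [Node l (Leaf pre)], where [l] lists rationals; returns the
   product of their denominators and the list of the numerators multiplied by
   [pre] and all the other denominators. *)
Definition scale_body :=
  EIf (EIsNum (EFst (EVar 0))) (EPair (ENum 1) (ENum 0))
    (ELet (EFst (EFst (EVar 0)))
      (ELet (ECall scale_id (EPair (ESnd (EFst (EVar 1)))
                 (EArith Mul (ESnd (EVar 1)) (ESnd (EVar 0)))))
         (EPair (EArith Mul (ESnd (EVar 1)) (EFst (EVar 0)))
            (EPair (EArith Mul (EFst (EVar 1))
                      (EArith Mul (ESnd (EVar 2)) (EFst (EVar 0))))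
               (ESnd (EVar 0)))))).

(** The search receives the scaled costs twice: in its context as data, and as the list to traverse,
    whose length provides the [n] iterations. *)
Definition entry :=
  ELet (ESnd (EVar 0)) (ELet (EFst (EFst (EVar 1)))
    (EIf (call_loop sat_id (EVar 0) (ENum 0) (EVar 1))
       (EPair (ENum 1) (ENum 1))
       (EIf (call_loop open_id (EVar 0) (ENum 0) (EVar 1))
          (ELet (ESnd (ECall scale_id
                         (EPair (ESnd (ESnd (EFst (EVar 2)))) (ENum 1))))
             (ELet (call_loop cheap_id (EVar 1) (ENum 0)
                      (EPair (EVar 2) (EVar 0)))
                (ELet (EArith Mul (call_loop size_id (EVar 2) (ENum 0) (ENum 0))
                         (ESnd (EVar 0)))
                   (call_loop search_id (EVar 2)
                      (EPair (ENum 1) (EPair (ENum 0) (ENum 0)))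
                      (EPair (EVar 3) (EPair (EVar 4)
                         (EPair (EVar 2) (EPair (EVar 0) (EFst (EVar 1))))))))))
          (EPair (ENum 1) (ENum 0))))).

Definition prog : program :=
  [:: entry; loop mem_id mem_step; loop look_id look_step;
      loop fals_id fals_step; loop unt_id unt_step; loop tcost_id tcost_step;
      loop cheap_id cheap_step; loop sat_id sat_step; loop open_id open_step;
      loop count_id count_step; loop greedy_id greedy_step;
      loop size_id size_step; loop search_id search_step_expr; scale_body].

(** * Evaluation cost counted in steps on numbers of bounded length *)

Lemma bitlen_leq m w : 0 < w -> m < 2 ^ w -> bitlen m <= w.
Proof.
move=> w0 lt; rewrite /bitlen; case: (posnP m) => [->|m0]; first by rewrite trunc_log0.
by rewrite -(@ltn_exp2l 2) // (leq_ltn_trans _ lt) // trunc_logP.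
Qed.

Lemma ltn_bitlen m : m < 2 ^ bitlen m.
Proof. exact: trunc_log_ltn. Qed.

Section Units.

Variable w : nat.
Hypothesis w2 : 1 < w.
Let N := 2 ^ w.

(* Bounds the cost of one step when all numbers read have at most [w] bits;
   [ev] counts such steps. *)
Definition unit_cost := (2 * (w * w)).+1.

Definition ev env e v c := exists2 t, t <= c * unit_cost & eval prog env e v t.

Definition fspec g a v c := ev [:: a] (body prog g) v c.

(** Lets a derivation produce its own value and cost, which are compared with the specification only
    afterwards. *)
Lemma ev_leq env e v v' c c' : ev env e v c -> v = v' -> c <= c' -> ev env e v' c'.
Proof.
move=> [t le H] <- cc; exists t => //; apply: leq_trans le _.
by rewrite leq_mul2r cc orbT.
Qed.

Lemma ev_var env i v : nth (Leaf 0) env i = v -> ev env (EVar i) v 1.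
Proof. by move<-; exists 1; [rewrite mul1n | constructor]. Qed.

Lemma ev_num env m : ev env (ENum m) (Leaf m) 1.
Proof. by exists 1; [rewrite mul1n | constructor]. Qed.

Lemma ev_arith env o e1 e2 a b c1 c2 :
  ev env e1 (Leaf a) c1 -> ev env e2 (Leaf b) c2 -> a < N -> b < N ->
  ev env (EArith o e1 e2) (Leaf (arith_sem o a b)) (c1 + c2).+1.
Proof.
move=> [t1 l1 H1] [t2 l2 H2] la lb; eexists; last exact: EvArith H1 H2.
have w0 : 0 < w by lia.
have le : arith_cost o a b <= 2 * (w * w).
  have := bitlen_leq w0 la; have := bitlen_leq w0 lb.
  rewrite /arith_cost; move: (bitlen a) (bitlen b) => x y ley lex.
  have sum_le : x + y <= 2 * (w * w).
    by rewrite mul2n -addnn leq_add // (leq_trans _ (leq_pmulr _ w0)).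
  have prod_le : x * y <= 2 * (w * w).
    by apply: (leq_trans (leq_mul lex ley)); rewrite mul2n -addnn leq_addr.
  by case: o.
rewrite mulSn mulnDl {1}/unit_cost addSn ltnS addnC leq_add //.
exact: leq_add.
Qed.

Lemma ev_pair env e1 e2 v1 v2 c1 c2 :
  ev env e1 v1 c1 -> ev env e2 v2 c2 ->
  ev env (EPair e1 e2) (Node v1 v2) (c1 + c2).+1.
Proof.
move=> [t1 l1 H1] [t2 l2 H2]; eexists; last exact: EvPair H1 H2.
by rewrite mulSn mulnDl -addn1 addnC leq_add // leq_add.
Qed.

Lemma ev_fst env e v1 v2 c : ev env e (Node v1 v2) c -> ev env (EFst e) v1 c.+1.
Proof.
by move=> [t l H]; eexists; [|exact: EvFst H]; rewrite mulSn -addn1 addnC leq_add.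
Qed.

Lemma ev_snd env e v1 v2 c : ev env e (Node v1 v2) c -> ev env (ESnd e) v2 c.+1.
Proof.
by move=> [t l H]; eexists; [|exact: EvSnd H]; rewrite mulSn -addn1 addnC leq_add.
Qed.

Lemma ev_isnum env e v c :
  ev env e v c -> ev env (EIsNum e) (Leaf (if v is Leaf _ then 1 else 0)) c.+1.
Proof.
by move=> [t l H]; eexists; [|exact: EvIsNum H]; rewrite mulSn -addn1 addnC leq_add.
Qed.

Lemma ev_let env e1 e2 v1 v2 c1 c2 :
  ev env e1 v1 c1 -> ev (v1 :: env) e2 v2 c2 ->
  ev env (ELet e1 e2) v2 (c1 + c2).+1.
Proof.
move=> [t1 l1 H1] [t2 l2 H2]; eexists; last exact: EvLet H1 H2.
by rewrite mulSn mulnDl -addn1 addnC leq_add // leq_add.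
Qed.

Lemma ev_call env g e v w' c1 c2 :
  ev env e v c1 -> fspec g v w' c2 -> ev env (ECall g e) w' (c1 + c2).+1.
Proof.
move=> [t1 l1 H1] [t2 l2 H2]; eexists; last exact: EvCall H1 H2.
by rewrite mulSn mulnDl -addn1 addnC leq_add // leq_add.
Qed.

(** Kept folded so that [ev_branch_step] can choose a rule by the form of the condition. *)
Definition ev_branch env m e1 e2 v c := ev env (if m == 0 then e2 else e1) v c.

Lemma ev_if env e e1 e2 m v c c' :
  ev env e (Leaf m) c -> ev_branch env m e1 e2 v c' ->
  ev env (EIf e e1 e2) v (c + c').+1.
Proof.
move=> [t1 l1 H1] [t2 l2 H2]; eexists; last exact: EvIf H1 H2.
by rewrite mulSn mulnDl -addn1 addnC leq_add // leq_add.
Qed.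

Lemma ev_branch0 env e1 e2 v c : ev env e2 v c -> ev_branch env 0 e1 e2 v c.
Proof. by []. Qed.

Lemma ev_branchS env m e1 e2 v c : ev env e1 v c -> ev_branch env m.+1 e1 e2 v c.
Proof. by []. Qed.

(** Adding the costs of both branches gives a bound independent of the condition; only the branch
    taken has to evaluate. *)
Lemma ev_branchb env (b : bool) e1 e2 v1 v2 c1 c2 :
  (b -> ev env e1 v1 c1) -> (~~ b -> ev env e2 v2 c2) ->
  ev_branch env b e1 e2 (if b then v1 else v2) (c1 + c2).
Proof.
rewrite /ev_branch; case: b => /= H1 H2.
  by apply: ev_leq (H1 isT) _ _ => //; rewrite leq_addr.
by apply: ev_leq (H2 isT) _ _ => //; rewrite leq_addl.
Qed.

Lemma ev_branchn env m e1 e2 v1 v2 c1 c2 :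
  (m != 0 -> ev env e1 v1 c1) -> (m == 0 -> ev env e2 v2 c2) ->
  ev_branch env m e1 e2 (if m == 0 then v2 else v1) (c1 + c2).
Proof.
rewrite /ev_branch; case: (m == 0) => /= H1 H2.
  by apply: ev_leq (H2 isT) _ _ => //; rewrite leq_addl.
by apply: ev_leq (H1 isT) _ _ => //; rewrite leq_addr.
Qed.

Lemma ev_eq env e1 e2 a b c1 c2 :
  ev env e1 (Leaf a) c1 -> ev env e2 (Leaf b) c2 -> a < N -> b < N ->
  ev env (EEq e1 e2) (Leaf (a == b)) (2 * (c1 + c2) + 4).
Proof.
move=> H1 H2 la lb; rewrite /EEq.
apply: (ev_leq (v := if a <= b then Leaf (b <= a) else Leaf 0)
                (c := ((c1 + c2).+1 + ((c2 + c1).+1 + 1)).+1)); last by lia.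
  apply: ev_if; first by apply: (ev_arith Leq H1 H2).
  by apply: ev_branchb => _; [apply: (ev_arith Leq H2 H1) | apply: ev_num].
by rewrite eqn_leq; case: (a <= b).
Qed.

(** [A] is the loop invariant: the accumulator as a function of the consumed prefix. The step is
    required only at positions of [l], so it may use bounds valid for prefixes of [l]. *)
Lemma loopP (g : nat) (step : expr) (X : Type) (enc : X -> Defs.val)
    (A : seq X -> Defs.val) (l : seq X) (ctx : Defs.val) (c M : nat) :
  body prog g = loop g step ->
  (forall l1 x l2 arg, l = l1 ++ x :: l2 ->
     ev [:: enc x; A l1; ctx; arg] step (A (rcons l1 x)) c) ->
  size l <= M ->
  fspec g (Node (enc_list (map enc l)) (Node (A [::]) ctx)) (A l)
        ((c + 40) * M + 40).
Proof.
move=> Eg Hs leM.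
suff H l2 l1 : l = l1 ++ l2 ->
    fspec g (Node (enc_list (map enc l2)) (Node (A l1) ctx)) (A l)
      ((c + 40) * size l2 + 40).
  by apply: ev_leq (H l [::] _) _ _ => //; rewrite leq_add2r leq_mul2l leM orbT.
elim: l2 l1 => [|x l2 IH] l1 El; rewrite /fspec Eg /loop.
  rewrite El cats0; eapply ev_leq; [| reflexivity |].
    eapply ev_if; [by eapply ev_isnum, ev_fst, ev_var|].
    by eapply ev_branchS, ev_fst, ev_snd, ev_var.
  by lia.
have := Hs l1 x l2 _ El.
set arg := Node _ _; move=> /(_ arg) H.
eapply ev_leq; [| reflexivity |].
  eapply ev_if; [by eapply ev_isnum, ev_fst, ev_var|].
  eapply ev_branch0, ev_call; last by apply: (IH (rcons l1 x)); rewrite cat_rcons.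
  eapply ev_pair; first by eapply ev_snd, ev_fst, ev_var.
  eapply ev_pair; last by eapply ev_snd, ev_snd, ev_var.
  eapply ev_let; first by eapply ev_snd, ev_snd, ev_var.
  eapply ev_let; first by eapply ev_fst, ev_snd, ev_var.
  eapply ev_let; first by eapply ev_fst, ev_fst, ev_var.
  exact: H.
by rewrite /= mulnS; lia.
Qed.

End Units.

Lemma ev_call_loop w env g l acc ctx vl va vc v c1 c2 c3 c4 :
  ev w env l vl c1 -> ev w env acc va c2 -> ev w env ctx vc c3 ->
  fspec w g (Node vl (Node va vc)) v c4 ->
  ev w env (call_loop g l acc ctx) v (c1 + (c2 + c3).+1 + c4).+2.
Proof.
move=> H1 H2 H3 H4.
apply: ev_leq (ev_call (ev_pair H1 (ev_pair H2 H3)) H4) _ _ => //.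
Qed.

Ltac ev_branch_step :=
  cbn [nth arith_sem];
  lazymatch goal with
  | |- ev_branch _ _ O _ _ _ _ => apply: ev_branch0
  | |- ev_branch _ _ (S _) _ _ _ _ => apply: ev_branchS
  | |- ev_branch _ _ (nat_of_bool _) _ _ _ _ => eapply ev_branchb; intro
  | |- ev_branch _ _ _ _ _ _ _ => eapply ev_branchn; intro
  end.

(** Applies the rule of the head constructor; bounds on operands and specifications of called
    functions remain as goals. *)
Ltac ev_step :=
  lazymatch goal with
  | |- ev _ _ (EVar _) _ _ => eapply ev_var; cbn [nth]; reflexivity
  | |- ev _ _ (ENum _) _ _ => eapply ev_num
  | |- ev _ _ (EEq _ _) _ _ => eapply ev_eq
  | |- ev _ _ (EArith _ _ _) _ _ => eapply ev_arith
  | |- ev _ _ (EPair _ _) _ _ => eapply ev_pair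
  | |- ev _ _ (EFst _) _ _ => eapply ev_fst
  | |- ev _ _ (ESnd _) _ _ => eapply ev_snd
  | |- ev _ _ (EIsNum _) _ _ => eapply ev_isnum
  | |- ev _ _ (ELet _ _) _ _ => eapply ev_let
  | |- ev _ _ (call_loop _ _ _ _) _ _ => eapply ev_call_loop
  | |- ev _ _ (ECall _ _) _ _ => eapply ev_call
  | |- ev _ _ (EIf _ _ _) _ _ => eapply ev_if
  | |- ev_branch _ _ _ _ _ _ _ => ev_branch_step
  end.

(* The constants are generous: only polynomial growth in [M] matters. *)
Definition loop_cost (M c : nat) : nat := (c + 40) * M + 40.
Definition cost_simple M := loop_cost M 60.
Definition cost_falsified M := loop_cost M (cost_simple M + 60).
Definition cost_untested M := loop_cost M (2 * cost_simple M + 60).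
Definition cost_cheapest M :=
  loop_cost M (cost_untested M + cost_falsified M + 100).
Definition cost_satisfied M :=
  loop_cost M (cost_falsified M + cost_untested M + 100).
Definition cost_open M := loop_cost M (cost_falsified M + 60).
Definition cost_count M := loop_cost M (cost_simple M + cost_falsified M + 60).
Definition cost_greedy M := loop_cost M (2 * cost_simple M + cost_count M + 150).
Definition cost_search M := loop_cost M (cost_greedy M + cost_simple M + 150).

(** * Correctness and cost of the program *)

Section Run.

Variables (n : nat) (f : mdnf n) (C : 'I_n -> nat) (w M : nat).

Let N := 2 ^ w.
Let total := \sum_(i < n) C i.

Hypothesis w2 : 1 < w.
Hypothesis nM : n <= M.
Hypothesis fM : size f <= M.
Hypothesis tM : forall t, t \in f -> size t <= M.
Hypothesis big : (n + size f + 3) * total.+1 < N.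

Definition enc_term (t : seq 'I_n) := enc_list [seq enc_var i | i <- t].
Definition enc_formula := enc_list [seq enc_term t | t <- f].
Definition enc_costs := enc_list [seq Leaf (C i) | i <- enum 'I_n].

Let lt_small m : m <= n + size f + 2 -> m < N.
Proof.
by move=> le; apply: leq_ltn_trans big; rewrite mulnS; lia.
Qed.

Let lt_ord (i : 'I_n) : i < N.
Proof. by apply: lt_small; have := ltn_ord i; lia. Qed.

Let lt_total m : m <= total -> m < N.
Proof. by move=> le; apply: leq_ltn_trans big; rewrite mulnS mulnDl; nia. Qed.

Let leC i : C i <= total.
Proof. by rewrite /total (bigD1 i) //= leq_addr. Qed.

Ltac small := first [assumption | exact: lt_ord | by apply: lt_small; lia
                    | by apply: lt_total | exact: lt_total (leC _)].

Lemma mem_spec (i : 'I_n) (t : seq 'I_n) : size t <= M ->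
  fspec w mem_id (Node (enc_term t) (Node (Leaf 0) (enc_var i)))
    (Leaf (i \in t)) (cost_simple M).
Proof.
apply: (@loopP w w2 mem_id mem_step _ (@enc_var n) (fun l => Leaf (i \in l)) _ _ _ _ erefl).
move=> l1 j l2 arg El; rewrite /mem_step; eapply ev_leq.
- by repeat ev_step; small.
- by rewrite mem_rcons inE (eq_sym i) -val_eqE; case: (_ == _).
- by [].
Qed.

Lemma look_leq2 (h : history n) i : look h i <= 2.
Proof.
elim/last_ind: h => // h a IH; rewrite /look foldl_rcons -/(look h i).
by case: (_ == _) => //; case: a.2.
Qed.

Lemma look_spec (h : history n) (i : 'I_n) : size h <= M ->
  fspec w look_id (Node (enc_history h) (Node (Leaf 2) (enc_var i)))
    (Leaf (look h i)) (cost_simple M).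
Proof.
apply: (@loopP w w2 look_id look_step _ _ (fun l => Leaf (look l i)) _ _ _ _ erefl).
move=> l1 [j b] l2 arg El; rewrite /look_step; eapply ev_leq.
- by repeat ev_step; small.
- by rewrite /look foldl_rcons /= -val_eqE; case: (_ == _).
- by [].
Qed.

Let lt_look (h : history n) i : look h i < N.
Proof. by apply: lt_small; have := look_leq2 h i; lia. Qed.

Lemma falsified_spec (h : history n) (t : seq 'I_n) : size h <= M -> size t <= M ->
  fspec w fals_id (Node (enc_term t) (Node (Leaf 0) (enc_history h)))
    (Leaf (falsified h t)) (cost_falsified M).
Proof.
move=> hM.
apply: (@loopP w w2 fals_id fals_step _ _ (fun l => Leaf (falsified h l)) _ _ _ _ erefl).
move=> l1 i l2 arg El; rewrite /fals_step; eapply ev_leq.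
- by repeat ev_step; exact: look_spec.
- by rewrite /falsified has_rcons; case: (look h i).
- by lia.
Qed.

Definition enc_test (r : option 'I_n) : Defs.val :=
  if r is Some i then enc_action (Test i) else Leaf 0.

Lemma untested_spec (h : history n) (t : seq 'I_n) : size h <= M -> size t <= M ->
  fspec w unt_id (Node (enc_term t) (Node (Leaf 0) (enc_history h)))
    (enc_test (untested h t)) (cost_untested M).
Proof.
move=> hM.
apply: (@loopP w w2 unt_id unt_step _ _ (fun l => enc_test (untested h l)) _ _ _ _ erefl).
move=> l1 i l2 arg El; rewrite /unt_step; eapply ev_leq.
- by repeat first [ev_step | exact: look_spec | exact: lt_look | small].
- by rewrite /untested foldl_rcons; case: (look h i == 2).
- by lia.
Qed.

Lemma term_cost_leq (s t : seq 'I_n) l : enum 'I_n = s ++ l ->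
  \sum_(i <- s | i \in t) C i <= total.
Proof.
move=> E; have -> : total = \sum_(i <- enum 'I_n) C i by rewrite big_enum.
rewrite E big_cat /=; apply: leq_trans (leq_addr _ _).
by rewrite big_mkcond leq_sum // => i _; case: ifP.
Qed.

(** Identifies the position counter of a loop over the costs with the current variable. *)
Lemma enum_ord_index (s l : seq 'I_n) i : enum 'I_n = s ++ i :: l -> size s = i.
Proof.
move=> E; have lt : size s < n.
  by move: (size_enum_ord n); rewrite E size_cat /=; lia.
by rewrite -[LHS](nth_enum_ord i lt) E nth_cat ltnn subnn.
Qed.

Lemma term_cost_spec (t : seq 'I_n) : size t <= M ->
  fspec w tcost_id (Node enc_costs (Node (Node (Leaf 0) (Leaf 0)) (enc_term t)))
    (Node (Leaf n) (Leaf (term_cost C t))) (cost_falsified M).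
Proof.
move=> sM.
have := @loopP w w2 tcost_id tcost_step _ (fun i => Leaf (C i))
  (fun l => Node (Leaf (size l)) (Leaf (\sum_(i <- l | i \in t) C i)))
  (enum 'I_n) (enc_term t) (cost_simple M + 60) M erefl.
rewrite size_enum_ord /= big_nil; apply => //.
move=> l1 i l2 arg El; rewrite /tcost_step.
have lti : size l1 < N by rewrite (enum_ord_index El) lt_ord.
eapply ev_leq.
- repeat first [ev_step | exact: term_cost_leq El | small].
    by rewrite (enum_ord_index El); apply: mem_spec.
  exact: lt_total (term_cost_leq _ El).
- rewrite size_rcons /= addn1 -cats1 big_cat big_cons big_nil /= (enum_ord_index El).
  by case: (i \in t); rewrite ?addn0.
- by lia.
Qed.

Definition enc_cheap (h : history n) (r : option (seq 'I_n)) : Defs.val :=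
  if r is Some t then Node (enc_test (untested h t)) (Leaf (term_cost C t))
  else Leaf 0.

Let leT t : term_cost C t <= total.
Proof. by apply: (@term_cost_leq _ _ [::]); rewrite cats0. Qed.

Lemma cheapest_spec (h : history n) : size h <= M ->
  fspec w cheap_id
    (Node enc_formula (Node (Leaf 0) (Node (enc_history h) enc_costs)))
    (enc_cheap h (cheapest f C h))
    (cost_cheapest M).
Proof.
move=> hM.
apply: (@loopP w w2 cheap_id cheap_step _ _
  (fun l => enc_cheap h (cheapest l C h)) _ _ _ _ erefl) => //.
move=> l1 t l2 arg El; rewrite /cheap_step /cheapest /ratio_min foldl_rcons.
have tf : size t <= M by apply: tM; rewrite El mem_cat inE eqxx orbT.
case Er: foldl => [y|] /=; have := untested_spec hM tf;
case Eu: (untested h t) => [i|] Hu /=; (eapply ev_leq;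
  [repeat first [ev_step | exact: Hu | exact: term_cost_spec
    | exact: lt_total (leT _) | small ] | rewrite ?Eu ?muln1 //= | by lia]).
by case: ifP => _ /=; rewrite ?Eu.
Qed.

Lemma satisfied_spec (h : history n) : size h <= M ->
  fspec w sat_id (Node enc_formula (Node (Leaf 0) (enc_history h)))
    (Leaf (has (satisfied h) f))
    (cost_satisfied M).
Proof.
move=> hM.
apply: (@loopP w w2 sat_id sat_step _ _
  (fun l => Leaf (has (satisfied h) l)) _ _ _ _ erefl) => //.
move=> l1 t l2 arg El; rewrite /sat_step has_rcons.
have tf : size t <= M by apply: tM; rewrite El mem_cat inE eqxx orbT.
have := untested_spec hM tf; case Eu: (untested h t) => [i|] Hu /=; (eapply ev_leq;
  [repeat first [ev_step | exact: Hu | exact: falsified_spec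
    | small ] | rewrite /satisfied ?Eu //= | by lia]).
- by rewrite andbF; case: falsified.
- by rewrite andbT; case: falsified.
Qed.

Lemma open_spec (h : history n) : size h <= M ->
  fspec w open_id (Node enc_formula (Node (Leaf 0) (enc_history h)))
    (Leaf (has (fun t => ~~ falsified h t) f))
    (cost_open M).
Proof.
move=> hM.
apply: (@loopP w w2 open_id open_step _ _
  (fun l => Leaf (has (fun t => ~~ falsified h t) l)) _ _ _ _ erefl) => //.
move=> l1 t l2 arg El; rewrite /open_step has_rcons.
have tf : size t <= M by apply: tM; rewrite El mem_cat inE eqxx orbT.
eapply ev_leq.
- by repeat first [ev_step | exact: falsified_spec | small ].
- by case: falsified.
- by lia.
Qed.

Lemma count_spec (h : history n) (i : 'I_n) : size h <= M ->
  fspec w count_id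
    (Node enc_formula (Node (Leaf 0) (Node (enc_var i) (enc_history h))))
    (Leaf (count_open f h i)) (cost_count M).
Proof.
move=> hM.
apply: (@loopP w w2 count_id count_step _ _
  (fun l => Leaf (count_open l h i)) _ _ _ _ erefl) => //.
move=> l1 t l2 arg El; rewrite /count_step /count_open -cats1 count_cat /= addn0.
have tf : size t <= M by apply: tM; rewrite El mem_cat inE eqxx orbT.
have lt : count_open l1 h i < N.
  apply: lt_small; apply: leq_trans (count_size _ _) _.
  by rewrite El size_cat; lia.
eapply ev_leq.
- by repeat first [ev_step | exact: falsified_spec | exact: mem_spec | small ].
- by case: (i \in t); case: falsified; rewrite /= ?addn0.
- by lia.
Qed.

Lemma size_spec : fspec w size_id (Node enc_formula (Node (Leaf 0) (Leaf 0)))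
  (Leaf (size f)) (cost_simple M).
Proof.
apply: (@loopP w w2 size_id size_step _ _ (fun l => Leaf (size l)) _ _ _ _ erefl) => //.
move=> l1 t l2 arg El; rewrite /size_step size_rcons.
have lt : size l1 < N by apply: lt_small; rewrite El size_cat; lia.
eapply ev_leq.
- by repeat first [ev_step | small ].
- by rewrite /= addn1.
- by lia.
Qed.

Definition enc_best (h : history n) (r : option 'I_n) : Defs.val :=
  if r is Some i then
    Node (enc_var i) (Node (Leaf (C i)) (Leaf (count_open f h i)))
  else Leaf 0.

Let lt_count (h : history n) i : count_open f h i < N.
Proof. by apply: lt_small; apply: leq_trans (count_size _ _) _; lia. Qed.

Let lt_mul a b : a <= size f -> b <= total -> a * b < N.
Proof.
move=> la lb; apply: leq_ltn_trans (leq_mul la lb) _.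
by apply: leq_ltn_trans big; rewrite mulnS !mulnDl; lia.
Qed.

Lemma greedy_spec (h : history n) : size h <= M ->
  fspec w greedy_id
    (Node enc_costs (Node (Node (Leaf 0) (Leaf 0))
                      (Node enc_formula (enc_history h))))
    (Node (Leaf n) (enc_best h (greedy f C h)))
    (cost_greedy M).
Proof.
move=> hM.
pose best l := ratio_min (fun i => (look h i == 2) && (0 < count_open f h i)) C
  (count_open f h) l.
have := @loopP w w2 greedy_id greedy_step _ (fun i => Leaf (C i))
  (fun l => Node (Leaf (size l)) (enc_best h (best l)))
  (enum 'I_n) (Node enc_formula (enc_history h))
  (2 * cost_simple M + cost_count M + 150) M erefl.
rewrite size_enum_ord /=; apply => //.
move=> l1 i l2 arg El; rewrite /greedy_step (enum_ord_index El) size_rcons.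
rewrite (enum_ord_index El) /best /ratio_min foldl_rcons -/(ratio_min _ _ _ _).
case: (ratio_min _ _ _ _) => [y|] /=; (eapply ev_leq;
  [repeat first [ev_step | exact: look_spec | exact: count_spec | exact: lt_look
     | exact: lt_count
     | by rewrite /= mulnC; apply: lt_mul => //; exact: count_size
     | small ] | | by lia]); rewrite /= addn1; congr Node.
- case: eqP => //= _; rewrite lt0n; case: eqP => //= _.
  by rewrite [C i * _]mulnC [C y * _]mulnC; case: ifP.
- by case: eqP => //= _; rewrite lt0n; case: eqP.
Qed.

Definition enc_state (s : 'I_n + history n * nat) : Defs.val :=
  match s with
  | inl i => enc_action (Test i)
  | inr (h0, K) => Node (Leaf 1) (Node (enc_history h0) (Leaf K))
  end.

(** The bounds under which [greedy_spec] applies to the simulated history and its total fits in [w]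
    bits. *)
Lemma search_bound h kc i1 m h0 K :
  search f C h kc i1 m = inr (h0, K) -> size h0 <= m /\ K <= m * total.
Proof.
elim: m h0 K => [|m IH] h0 K; first by case=> <- <-.
rewrite /search iterS -/(search f C h kc i1 m).
case: (search _ _ _ _ _ _) IH => [//|[h1 K1]] /(_ _ _ erefl)[sz leK] /=.
case: greedy => [g|]; last by case=> <- <-; split; [lia | rewrite mulSn; lia].
case: ifP => // _; case: ifP => // _ [<- <-]; split=> //=.
by rewrite mulSnr leq_add.
Qed.

Lemma search_spec (h : history n) kc (i1 : 'I_n) : size h <= M -> kc < N ->
  fspec w search_id
    (Node enc_costs (Node (Node (Leaf 1) (Node (Leaf 0) (Leaf 0)))
      (Node enc_formula (Node (enc_history h)
        (Node enc_costs (Node (Leaf kc) (enc_action (Test i1))))))))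
    (enc_state (search f C h kc i1 n))
    (cost_search M).
Proof.
move=> hM ltk.
have := @loopP w w2 search_id search_step_expr _ (fun i => Leaf (C i))
  (fun l => enc_state (search f C h kc i1 (size l)))
  (enum 'I_n) (Node enc_formula (Node (enc_history h)
        (Node enc_costs (Node (Leaf kc) (enc_action (Test i1))))))
  (cost_greedy M
           + cost_simple M + 150) M erefl.
rewrite size_enum_ord /=; apply => //.
move=> l1 i l2 arg El; rewrite /search_step_expr size_rcons (enum_ord_index El).
have := @search_bound h kc i1 i.
rewrite /search iterS -/(search f C h kc i1 i).
case: (search _ _ _ _ _ _) => [j|[h0 K]] /= Hb.
  by eapply ev_leq; [repeat ev_step| | by lia].
have [szh0 leK] := Hb _ _ erefl; have h0M : size h0 <= M.
  by apply: (leq_trans szh0); apply: leq_trans nM; exact: ltnW (ltn_ord i).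
have bK g : K + C g < N.
  apply: leq_ltn_trans (leq_add leK (leC g)) _; rewrite -mulSnr.
  apply: leq_ltn_trans big; apply: leq_mul => //.
  by have := ltn_ord i; lia.
have bK0 (g : 'I_n) : K < N by apply: (leq_ltn_trans _ (bK g)); rewrite leq_addr.
have := greedy_spec h0M; case: greedy => [g|] /= Hg; (eapply ev_leq;
  [repeat first [ev_step | exact: Hg | exact: look_spec | exact: lt_look
     | exact: bK0 g | exact: bK | small ] | | by lia]) => //=.
case: ifP => //= _; case: eqP => //= ne.
by have := look_leq2 h g; case: (look h g) ne => [|[|[]]].
Qed.

Definition entry_cost : nat :=
  cost_satisfied M +
  cost_open M +
  60 * M.+1 +
  cost_cheapest M +
  cost_simple M +
  cost_search M + 200.

(** The program has no counterpart of the default output of [strat] for a missing next test; the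
    last hypothesis, supplied later by [next_testP], excludes that case. *)
Lemma entry_spec (vp vc : Defs.val) D (h : history n) :
  size h <= M ->
  fspec w scale_id (Node vc (Leaf 1)) (Node (Leaf D) enc_costs) (60 * M.+1) ->
  (~~ has (satisfied h) f -> has (fun t => ~~ falsified h t) f ->
   next_test f C h) ->
  fspec w 0 (Node (Node enc_formula (Node vp vc)) (enc_history h))
    (enc_action (strat f C h)) entry_cost.
Proof.
move=> hM Hscale Hnext; rewrite /fspec /= /entry /strat.
have Hsat := satisfied_spec hM; have Hopen := open_spec hM.
have [sat|/[dup] nsat /Hnext {}Hnext] := boolP (has (satisfied h) f).
  rewrite sat /= in Hsat; eapply ev_leq;
    [repeat first [ev_step | exact: Hsat] | by [] | rewrite /entry_cost; lia].
rewrite (negbTE nsat) /= in Hsat.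
have [op|nop] := boolP (has _ f); last first.
  rewrite (negbTE nop) /= in Hopen; eapply ev_leq;
    [repeat first [ev_step | exact: Hsat | exact: Hopen] | by []
    | rewrite /entry_cost; lia].
rewrite op /= in Hopen; move: (Hnext op); rewrite /next_test.
have := cheapest_spec hM; case: cheapest => // t.
rewrite /enc_cheap; case: (untested h t) => // i1 Hcheap.
have lt_sizef : size f < N by apply: lt_small; lia.
have lt_kc : size f * term_cost C t < N by apply: lt_mul.
have := search_spec i1 hM lt_kc; case: (search _ _ _ _ _ _) => // i Hsearch _.
eapply ev_leq;
    [repeat first [ev_step | exact: Hsat | exact: Hopen | exact: Hscale
     | exact: Hcheap | exact: size_spec | exact: Hsearch | exact: lt_total (leT _)
     | small ] | by []
    | rewrite /entry_cost; lia].
Qed.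

End Run.

(** * Clearing the denominators of the costs *)

Section Scale.

Variables (w n : nat) (num den : 'I_n -> nat).
Let N := 2 ^ w.
Hypothesis w2 : 1 < w.
Hypothesis den_gt0 : forall i, 0 < den i.

Definition enc_frac i := Node (Leaf (num i)) (Leaf (den i)).

(** The recursion hands the denominators already seen down in [pre] and returns the product of the
    later ones, so each numerator meets all denominators but its own. The successor in the bound
    keeps the factors positive when a numerator is 0, so every operand is at most the whole
    product. *)
Lemma scale_spec (s : seq 'I_n) pre :
  uniq s -> 0 < pre -> pre * \prod_(i <- s) ((num i).+1 * den i) < N ->
  fspec w scale_id (Node (enc_list (map enc_frac s)) (Leaf pre))
    (Node (Leaf (\prod_(i <- s) den i))
       (enc_list [seq Leaf (num i * (pre * \prod_(j <- s | j != i) den j)) | i <- s]))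
    (60 * (size s).+1).
Proof.
elim: s pre => [|a s IH] pre /=.
  move=> _ _ _; rewrite /fspec /= /scale_body big_nil; eapply ev_leq;
    [by repeat ev_step | by [] | by []].
move=> /andP[a_notin us] pre0; rewrite !big_cons => lt.
have prod_gt0 (r : seq 'I_n) (Q : pred 'I_n) (F : 'I_n -> nat) :
    (forall i, 0 < F i) -> 0 < \prod_(i <- r | Q i) F i.
  by move=> F0; elim/big_ind: _ => // x y; rewrite muln_gt0 => -> ->.
have ge1 : 0 < \prod_(i <- s) ((num i).+1 * den i).
  by apply: prod_gt0 => i; rewrite muln_gt0 den_gt0.
have ge_den : \prod_(i <- s) den i <= \prod_(i <- s) ((num i).+1 * den i).
  by apply: leq_prod => i _; rewrite leq_pmull.
have den0 := den_gt0 a.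
have sden0 : 0 < \prod_(i <- s) den i by exact: prod_gt0.
set Q := \prod_(i <- s) ((num i).+1 * den i) in lt ge1 ge_den IH.
set d := \prod_(i <- s) den i in ge_den sden0.
have bound x : x <= pre * ((num a).+1 * den a * Q) -> x < N by move=> /leq_ltn_trans; apply.
have lt_pre : pre < N by apply: bound; rewrite leq_pmulr // !muln_gt0 den0.
have lt_den : den a < N.
  by apply: bound; rewrite mulnCA mulnC !mulnA leq_pmull // !muln_gt0 pre0 ge1.
have lt_num : num a < N.
  apply: bound; rewrite -!mulnA mulnCA.
  apply: leq_trans (leq_pmulr _ _); first exact: leqnSn.
  by rewrite !muln_gt0 pre0 den0.
have lt_d : d < N.
  by apply: bound; apply: leq_trans ge_den _; rewrite mulnA leq_pmull // !muln_gt0 pre0 den0.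
have lt_pred : pre * d < N.
  by apply: bound; rewrite leq_mul2l (leq_trans ge_den) ?orbT // leq_pmull // muln_gt0 den0.
have := IH (pre * den a) us; rewrite muln_gt0 pre0 den0 => /(_ isT).
have lt' : pre * den a * Q < N.
  by apply: bound; rewrite -mulnA leq_mul2l leq_mul2r leq_pmull ?orbT.
move=> /(_ lt'); rewrite -/d => Hs.
have -> : [seq Leaf (num i * (pre * \prod_(j <- a :: s | j != i) den j)) | i <- s]
    = [seq Leaf (num i * (pre * den a * \prod_(j <- s | j != i) den j)) | i <- s].
  apply/eq_in_map => i si; rewrite big_cons.
  have -> : a != i by apply: contraNneq a_notin => ->.
  by rewrite !mulnA.
rewrite eqxx /=; have -> : \prod_(j <- s | j != a) den j = d.
  rewrite big_seq_cond [d]big_seq; apply: eq_bigl => j.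
  by rewrite andb_idr // => sj; apply: contraNneq a_notin => <-.
rewrite /fspec [body _ _]/= /scale_body; eapply ev_leq;
    [repeat first [ev_step | exact: Hs | assumption] | by [] | by rewrite mulnS; lia].
Qed.

End Scale.

Section Scaling.

Variables (n : nat) (c : 'I_n -> rat).
Hypothesis c_ge0 : forall i, (0 <= c i)%R.

Let num i := `|numq (c i)|%N.
Let den i := `|denq (c i)|%N.

Definition common_den : nat := \prod_i den i.
Definition scaled_cost (i : 'I_n) : nat := num i * \prod_(j | j != i) den j.

Lemma common_den_gt0 : 0 < common_den.
Proof. by apply: prodn_gt0 => i; rewrite /den absz_gt0 denq_neq0. Qed.

Lemma scaled_costE i : ((scaled_cost i)%:R = common_den%:R * c i :> rat)%R.
Proof.
have -> : common_den = den i * \prod_(j | j != i) den j by exact: bigD1.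
rewrite /scaled_cost !natrM mulrAC; congr (_ * _)%R.
have num_ge0 : (0 <= numq (c i))%R by rewrite numq_ge0.
rewrite -[c i in RHS]divq_num_den /num /den mulrC !pmulrn !gez0_abs ?denq_ge0 //.
by rewrite mulfVK // intr_eq0 denq_neq0.
Qed.

End Scaling.

(** * Input size and polynomial running time *)

Lemma vsize_enc_list (l : seq Defs.val) :
  vsize (enc_list l) = (\sum_(v <- l) vsize v + size l).+1.
Proof.
elim: l => [|v l IH] /=; first by rewrite big_nil.
by rewrite IH big_cons addnS addnS addnA.
Qed.

Lemma vsize_enc_vector n (u : 'I_n -> rat) :
  vsize (enc_vector u) = (\sum_i vsize (enc_rat (u i)) + n).+1.
Proof.
by rewrite /enc_vector vsize_enc_list big_map big_enum size_map size_enum_ord.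
Qed.

Section Instance.

Variables (n : nat) (f : mdnf n) (p c : 'I_n -> rat).

Let num i := `|numq (c i)|%N.
Let den i := `|denq (c i)|%N.
Let s := vsize (enc_instance f p c).

Let size_instance : n + size f <= s.
Proof.
by rewrite /s /= !vsize_enc_vector vsize_enc_list size_map; lia.
Qed.

Let size_term t : t \in f -> size t <= s.
Proof.
move=> tf; have : size t < vsize (enc_term t).
  by rewrite vsize_enc_list size_map ltnS leq_addl.
have : vsize (enc_term t) <= vsize (enc_formula f).
  rewrite [in X in _ <= X]vsize_enc_list big_map (big_rem t) //= -!addnA; lia.
by rewrite /s /= -/(enc_formula f); lia.
Qed.

(** A number plus one is at most 2 to its bit length, and the bit lengths of all numerators and
    denominators sum to at most the input size. *)
Let prod_bound : \prod_i ((num i).+1 * den i) <= 2 ^ s.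
Proof.
have le : \sum_i (bitlen (num i) + bitlen (den i)) <= s.
  have -> : s = (vsize (enc_formula f) +
      (vsize (enc_vector p) + vsize (enc_vector c)).+1).+1 by [].
  rewrite !vsize_enc_vector.
  have : \sum_i (bitlen (num i) + bitlen (den i)) <= \sum_i vsize (enc_rat (c i)).
    by apply: leq_sum => i _ /=.
  lia.
apply: leq_trans (leq_pexp2l _ le) => //; rewrite expn_sum.
by apply: leq_prod => i _; rewrite expnD leq_mul // ?ltn_bitlen // ltnW ?ltn_bitlen.
Qed.

Let scaled_cost_leq i : scaled_cost c i <= 2 ^ s.
Proof.
apply: leq_trans prod_bound; rewrite (bigD1 i) //= leq_mul //.
  by rewrite (leq_trans (leqnSn _)) // leq_pmulr // absz_gt0 denq_neq0.
by apply: leq_prod => j _; rewrite leq_pmull.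
Qed.

Definition program_cost (m : nat) : nat :=
  entry_cost m * unit_cost (4 * m + 4).

Lemma program_correct (h : history n) :
  size h <= n ->
  (~~ has (satisfied h) f -> has (fun t => ~~ falsified h t) f ->
   next_test f (scaled_cost c) h) ->
  exists2 t, t <= program_cost s &
    runs prog (Node (enc_instance f p c) (enc_history h))
      (enc_action (strat f (scaled_cost c) h)) t.
Proof.
move=> hn; have sz := size_instance.
have pow2 : s < 2 ^ s by exact: ltn_expl.
(* Word length: [n + size f + 3] is at most [4 * 2 ^ s] and the total cost is below [2 ^ s * 2 ^ s],
   so the product in [big] is at most [4 * 2 ^ (3 * s)], which is below [2 ^ (4 * s + 4)]. *)
apply: (@entry_spec n f (scaled_cost c) (4 * s + 4) s) => //; try lia.
  have le : \sum_(i < n) scaled_cost c i <= s * 2 ^ s.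
    apply: leq_trans (leq_sum _ (fun i _ => scaled_cost_leq i)) _.
    by rewrite sum_nat_const card_ord leq_mul2r; apply/orP; right; lia.
  have -> : 4 * s + 4 = (s + s) + (s + s) + 4 by lia.
  rewrite !expnD; set e := 2 ^ s in le pow2 *.
  have : s * e < e * e by rewrite ltn_mul2r pow2 andbT; lia.
  have : s + 3 <= 4 * e by lia.
  move: (\sum_(i < n) _) le => T le le1 le2.
  have le3 : (n + size f + 3) * T.+1 <= (4 * e) * (e * e) by apply: leq_mul; lia.
  apply: leq_ltn_trans le3 _; have e0 : 0 < e by lia.
  rewrite [_ ^ 4]/=; have : 0 < e * e * (e * e) by rewrite !muln_gt0 e0.
  have : 4 * e * (e * e) <= 4 * (e * e * (e * e)) by nia.
  lia.
have -> : enc_vector c = enc_list (map (enc_frac num den) (enum 'I_n)) by [].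
have den_gt0 i : 0 < den i by rewrite absz_gt0 denq_neq0.
have := @scale_spec (4 * s + 4) n num den _ den_gt0 (enum 'I_n) 1 (enum_uniq _) isT.
rewrite !big_enum mul1n /= => H.
apply: ev_leq (H _ _) _ _; first lia.
- by apply: leq_ltn_trans prod_bound _; rewrite ltn_exp2l //; lia.
- congr (Node _ _); rewrite /enc_costs; congr enc_list; apply: eq_map => i.
  by rewrite mul1n big_enum_cond.
- by rewrite size_enum_ord; lia.
Qed.

End Instance.

(** Functions bounded by a polynomial are closed under sums and products, and the cost is built from
    these. *)
Lemma program_cost_poly : exists q : {poly nat}, forall m, program_cost m <= q.[m]%R.
Proof.
pose bounded (F : nat -> nat) := exists q : {poly nat}, forall m, F m <= q.[m]%R.
have bD F G : bounded F -> bounded G -> bounded (fun m => F m + G m).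
  by move=> [q Hq] [r Hr]; exists (q + r)%R => m; rewrite hornerD leq_add.
have bM F G : bounded F -> bounded G -> bounded (fun m => F m * G m).
  by move=> [q Hq] [r Hr]; exists (q * r)%R => m; rewrite hornerM leq_mul.
have bS F : bounded F -> bounded (fun m => (F m).+1).
  move=> [q Hq]; exists (q + 1%:P)%R => m.
  by rewrite hornerD hornerC [(_ + _)%R]addn1; exact: Hq.
have bC a : bounded (fun=> a).
  by exists (a%:P)%R => m; rewrite hornerC.
have bX : bounded id by exists 'X%R => m; rewrite hornerX.
have bl F : bounded F -> bounded (fun m => loop_cost m (F m)).
  by move=> bF; exact: bD (bM _ _ (bD _ _ bF (bC 40)) bX) (bC 40).
have b_simple : bounded cost_simple by exact: bl (bC 60).
have b_fals : bounded cost_falsified by exact: bl (bD _ _ b_simple (bC 60)).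
have b_unt : bounded cost_untested.
  by exact: bl (bD _ _ (bM _ _ (bC 2) b_simple) (bC 60)).
have b_cheap : bounded cost_cheapest.
  by exact: bl (bD _ _ (bD _ _ b_unt b_fals) (bC 100)).
have b_sat : bounded cost_satisfied.
  by exact: bl (bD _ _ (bD _ _ b_fals b_unt) (bC 100)).
have b_open : bounded cost_open by exact: bl (bD _ _ b_fals (bC 60)).
have b_count : bounded cost_count.
  by exact: bl (bD _ _ (bD _ _ b_simple b_fals) (bC 60)).
have b_greedy : bounded cost_greedy.
  by exact: bl (bD _ _ (bD _ _ (bM _ _ (bC 2) b_simple) b_count) (bC 150)).
have b_search : bounded cost_search.
  by exact: bl (bD _ _ (bD _ _ b_greedy b_simple) (bC 150)).
have b_scale := bM _ _ (bC 60) (bS _ bX).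
have b_bits := bD _ _ (bM _ _ (bC 4) bX) (bC 4).
have b_unit := bS _ (bM _ _ (bC 2) (bM _ _ b_bits b_bits)).
exact: bM (bD _ _ (bD _ _ (bD _ _ (bD _ _ (bD _ _ (bD _ _ b_sat b_open) b_scale)
  b_cheap) b_simple) b_search) (bC 200)) b_unit.
Qed.

(** * Tests and certificates *)

Lemma ratio_minP (T : eqType) (ok : pred T) (a b : T -> nat) (s : seq T) :
  (forall x, ok x -> 0 < b x) ->
  match ratio_min ok a b s with
  | Some y => [/\ y \in s, ok y &
                forall x, x \in s -> ok x -> a y * b x <= a x * b y]
  | None => forall x, x \in s -> ~~ ok x
  end.
Proof.
move=> b0; elim/last_ind: s => [//|s z]; rewrite /ratio_min foldl_rcons.
rewrite -/(ratio_min ok a b s); case: (ratio_min ok a b s) => [y|] IH.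
  have [ys oky miny] := IH; case: ifPn => [okz|nokz].
    case: leqP => [le|lt].
      split; rewrite ?mem_rcons ?inE ?ys ?orbT // => x; rewrite mem_rcons inE.
      by case/orP=> [/eqP-> //|xs okx]; apply: miny.
    split; rewrite ?mem_rcons ?inE ?eqxx // => x; rewrite mem_rcons inE.
    (* Transitivity of the cross-multiplied order from [z] over [y] to [x]: multiply by the missing
       denominators and cancel [b y]. *)
    case/orP=> [/eqP-> //|xs okx]; rewrite -(leq_pmul2r (b0 _ oky)).
    have := miny _ xs okx; rewrite -(leq_pmul2r (b0 _ okz)).
    move: lt => /ltnW; rewrite -(leq_pmul2r (b0 _ okx)); nia.
  split; rewrite ?mem_rcons ?inE ?ys ?orbT // => x; rewrite mem_rcons inE.
  by case/orP=> [/eqP->|xs]; [rewrite (negbTE nokz) | apply: miny].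
case: ifPn => [okz|nokz].
  split; rewrite ?mem_rcons ?inE ?eqxx // => x; rewrite mem_rcons inE.
  by case/orP=> [/eqP-> //|/IH/negbTE->].
by move=> x; rewrite mem_rcons inE => /orP[/eqP->|/IH].
Qed.

Section Knowledge.

Variables (n : nat) (f : mdnf n) (C : 'I_n -> nat) (x : assignment n).
Implicit Types (h : history n) (t : seq 'I_n) (i : 'I_n).

Definition consistent h := all (fun a => x a.1 == a.2) h.

Lemma lookE h i : consistent h ->
  look h i = if i \in unzip1 h then nat_of_bool (x i) else 2.
Proof.
elim/last_ind: h => // h [j b] IH; rewrite /consistent all_rcons => /andP[/eqP/= xj ch].
rewrite /look foldl_rcons -/(look h i) IH // /unzip1 map_rcons mem_rcons inE eq_sym.
by case: eqP => //= ->; rewrite xj.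
Qed.

Lemma look_untested h i : consistent h -> (look h i == 2) = (i \notin unzip1 h).
Proof. by move/lookE->; case: ifP => //; case: (x i). Qed.

Lemma falsifiedE h t : consistent h ->
  falsified h t = has (fun i => (i \in unzip1 h) && ~~ x i) t.
Proof.
move=> ch; apply: eq_has => i; rewrite lookE //.
by case: ifP => //; case: (x i).
Qed.

Lemma untestedP h t : consistent h ->
  if untested h t is Some i then i \in t /\ i \notin unzip1 h
  else {subset t <= unzip1 h}.
Proof.
move=> ch; elim/last_ind: t => [//|t i]; rewrite /untested foldl_rcons.
rewrite -/(untested h t) (look_untested _ ch); case: ifPn => ti.
  by rewrite mem_rcons inE eqxx.
case: (untested h t) => [j [jt jh]|IH]; first by rewrite mem_rcons inE jt orbT.
by move=> j; rewrite mem_rcons inE => /orP[/eqP->|/IH//]; rewrite negbK in ti.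
Qed.

Lemma falsified_eval h t : consistent h -> falsified h t -> ~~ all x t.
Proof.
move=> ch; rewrite falsifiedE // => /hasP[i it /andP[_ xi]].
by apply/allPn; exists i.
Qed.

Lemma satisfiedE h t : consistent h ->
  satisfied h t = all (fun i => (i \in unzip1 h) && x i) t.
Proof.
move=> ch; rewrite /satisfied falsifiedE //; have := untestedP t ch.
case: (untested h t) => [i [it ih]|sub] /=; apply/idP/idP; rewrite ?andbF ?andbT //.
- by move/allP => /(_ _ it); rewrite (negbTE ih).
- move=> /hasPn nf; apply/allP => i it; rewrite (sub i it) /=.
  by have := nf i it; rewrite (sub i it) /= negbK.
- by move/allP => al; apply/hasPn => i /al/andP[-> ->].
Qed.

Lemma consistent_known h i : consistent h ->
  known h i = if i \in unzip1 h then Some (x i) else None.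
Proof.
move=> ch; rewrite ffunE.
have mem b : (i, b) \in h -> x i = b by move=> ih; apply/eqP/(allP ch _ ih).
case: ifPn => [ih|ih1]; first by rewrite (mem _ ih) (map_f fst ih).
case: ifPn => [ih|ih0]; first by rewrite (mem _ ih) (map_f fst ih).
case: ifPn => // /mapP[[j []]] /= jh ij; rewrite ij in ih1 ih0.
  by rewrite jh in ih1.
by rewrite jh in ih0.
Qed.

Lemma contains_known h (y : assignment n) : consistent h ->
  contains y (known h) = [forall i in unzip1 h, y i == x i].
Proof.
move=> ch; apply: eq_forallb => i; rewrite consistent_known //.
by case: ifP => //= _; rewrite eq_sym.
Qed.

(** By monotonicity the worst completion for value 1 sets every untested variable to 0. *)
Lemma is_cert_true h : consistent h ->
  is_cert f true (known h) = has (satisfied h) f.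
Proof.
move=> ch; apply/forallP/hasP => [cert|[t tf sat] y].
  pose y : assignment n := [ffun i => (i \in unzip1 h) && x i].
  have := cert y; rewrite contains_known //; case: forall_inP => [_|[]]; last first.
    by move=> i ih; rewrite ffunE ih.
  move=> /eqP/hasP[t tf al]; exists t => //; rewrite satisfiedE //.
  by apply: sub_all al => i; rewrite ffunE.
apply/implyP; rewrite contains_known // => /forall_inP eqy.
rewrite eqb_id; apply/hasP; exists t => //.
move: sat; rewrite satisfiedE //; apply: sub_all => i /andP[ih xi].
by rewrite (eqP (eqy i ih)).
Qed.

(** Dually, the worst completion for value 0 sets every untested variable to 1. *)
Lemma is_cert_false h : consistent h ->
  is_cert f false (known h) = ~~ has (fun t => ~~ falsified h t) f.
Proof.
move=> ch; rewrite -all_predC; apply/forallP/allP => [cert t tf|fals y].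
  pose y : assignment n := [ffun i => (i \in unzip1 h) ==> x i].
  have := cert y; rewrite contains_known //; case: forall_inP => [_|[]]; last first.
    by move=> i ih; rewrite ffunE ih.
  rewrite eqbF_neg => /hasPn /(_ t tf) /allPn[i it].
  rewrite ffunE negb_imply => ihx; rewrite /= negbK falsifiedE //.
  by apply/hasP; exists i.
apply/implyP; rewrite contains_known // => /forall_inP eqy.
rewrite eqbF_neg; apply/hasPn => t /fals; rewrite /= negbK falsifiedE //.
move=> /hasP[i it /andP[ih xi]]; apply/allPn; exists i => //.
by rewrite (eqP (eqy i ih)).
Qed.

Lemma falsified_sub h0 h t : consistent h0 -> consistent h ->
  {subset unzip1 h0 <= unzip1 h} -> falsified h0 t -> falsified h t.
Proof.
move=> c0 ch sub; rewrite !falsifiedE //; apply: sub_has => i /andP[/sub -> ->].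
by [].
Qed.

Lemma cheapestP h :
  if cheapest f C h is Some t then
    [/\ t \in f, untested h t &
        forall u, u \in f -> untested h u -> term_cost C t <= term_cost C u]
  else forall t, t \in f -> ~~ untested h t.
Proof.
have := @ratio_minP _ (fun t => untested h t : bool) (term_cost C) (fun=> 1) f
  (fun _ _ => isT).
rewrite -/(cheapest f C h); case: cheapest => // t [tf ut mint]; split=> // u uf uu.
by have := mint u uf uu; rewrite !muln1.
Qed.

Lemma greedyP h : consistent h ->
  if greedy f C h is Some g then
    [/\ g \notin unzip1 h, 0 < count_open f h g &
        forall i, i \notin unzip1 h -> 0 < count_open f h i ->
          C g * count_open f h i <= C i * count_open f h g]
  else forall i, i \notin unzip1 h -> count_open f h i = 0.
Proof.
move=> ch.
have := @ratio_minP _ (fun i => (look h i == 2) && (0 < count_open f h i)) C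
  (count_open f h) (enum 'I_n).
rewrite -/(greedy f C h); case: greedy => [g|] /(_ (fun i => fun H => proj2 (andP H))).
  case=> _; rewrite look_untested // => /andP[gh cg] ming; split=> // i ih ci.
  by apply: ming; rewrite ?mem_enum // look_untested // ih.
move=> H i ih; have := H i; rewrite mem_enum look_untested // ih /= => /(_ isT).
by rewrite -eqn0Ngt => /eqP.
Qed.

(** * The greedy run and its simulation *)

Definition cost h := \sum_(a <- h) C a.1.

(** The greedy algorithm on its own, with [x] answering its tests; the newest test is at the head,
    as in [search_step]. *)
Definition run_step h : history n :=
  if greedy f C h is Some g then (g, x g) :: h else h.

Definition run (m : nat) : history n := iter m run_step [::].

Lemma run_consistent m : consistent (run m).
Proof.
elim: m => //= m IH; rewrite /run_step; case: greedy => //= g.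
by rewrite eqxx.
Qed.

Lemma run_uniq m : uniq (unzip1 (run m)).
Proof.
elim: m => //= m IH; rewrite /run_step; have := greedyP (run_consistent m).
by case: greedy => //= g [-> _ _].
Qed.

Lemma uniq_size_leq h : uniq (unzip1 h) -> size h <= n.
Proof. by move/card_uniqP; rewrite size_map => <-; rewrite -[X in _ <= X]card_ord max_card. Qed.

Lemma run_size m : greedy f C (run m) -> size (run m) = m.
Proof.
elim: m => //= m IH; rewrite /run_step; case E: (greedy f C (run m)) => [g|] /=.
  by rewrite IH // E.
by rewrite E.
Qed.

(** A further test would make [n + 1] distinct variables. *)
Lemma greedy_run_final : greedy f C (run n) = None.
Proof.
case E: (greedy f C (run n)) => [g|] //.
have := uniq_size_leq (run_uniq n.+1); rewrite /= /run_step E /=.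
by rewrite run_size ?E // ltnn.
Qed.

Lemma run_mono m k : exists s, run (m + k) = s ++ run m.
Proof.
elim: k => [|k [s Es]]; first by exists [::]; rewrite addn0.
rewrite addnS /= Es /run_step; case: greedy => [g|]; last by exists s.
by exists ((g, x g) :: s).
Qed.

Lemma run_final m : exists s, run n = s ++ run m.
Proof.
have [le|/ltnW le] := leqP m n.
  by have [s Es] := run_mono m (n - m); exists s; rewrite -Es subnKC.
have E k : run (n + k) = run n.
  elim: k => [|k IH]; first by rewrite addn0.
  by rewrite addnS /= IH /run_step greedy_run_final.
by exists [::]; rewrite /= -(E (m - n)) subnKC.
Qed.

Lemma run_leq m k : m <= k -> exists s, run k = s ++ run m.
Proof. by move/subnKC=> <-; apply: run_mono. Qed.

(** The untested variable of the open term is untested in the smaller history too, where the term is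
    also open. Hence the simulation cannot run dry before the strategy is done. *)
Lemma greedy_open h0 h t : consistent h0 -> consistent h ->
  {subset unzip1 h0 <= unzip1 h} -> t \in f -> ~~ falsified h t -> untested h t ->
  greedy f C h0.
Proof.
move=> c0 ch sub tf nf ut; have := greedyP c0; case: greedy => // H.
have := untestedP t ch; case: untested ut => // i _ [it ih].
have := H i (contra (@sub i) ih); rewrite /count_open => /eqP.
rewrite -leqn0 leqNgt -has_count => /hasPn /(_ t tf); rewrite it /=.
by move/negPn => /(falsified_sub c0 ch sub) fals; rewrite fals in nf.
Qed.

(** While no test is chosen, all simulated tests already occur in [h], so their looked-up outcomes
    are the true ones and the simulated history is the real greedy run. *)
Lemma searchP h kc i1 t m : consistent h ->
  t \in f -> ~~ falsified h t -> untested h t ->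
  match search f C h kc i1 m with
  | inl i => exists m',
      i = i1 /\ kc <= cost (run m') \/
      [/\ i \in unzip1 (run m'), i \notin unzip1 h & cost (run m') < kc]
  | inr (h0, K) =>
      [/\ h0 = run m, K = cost (run m), size h0 = m &
          {subset unzip1 h0 <= unzip1 h}]
  end.
Proof.
move=> ch tf nf ut; elim: m => [|m]; first by split=> //; rewrite /cost big_nil.
rewrite /search iterS -/(search f C h kc i1 m).
case: (search _ _ _ _ _ _) => [//|[h0 K] [-> -> sz sub]] /=.
have := greedy_open (run_consistent m) ch sub tf nf ut.
case E: (greedy f C (run m)) => [g|] // _.
have Er : run m.+1 = (g, x g) :: run m by rewrite /= /run_step E.
have Ec : cost (run m) + C g = cost (run m.+1).
  by rewrite Er /cost big_cons addnC.
rewrite Ec; case: leqP => le; first by exists m.+1; left.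
rewrite look_untested //; case: ifPn => gh.
  by exists m.+1; right; split=> //; rewrite Er /= inE eqxx.
rewrite negbK in gh; split=> //.
- by rewrite -/(run_step _) -[run_step _]/(run m.+1) Er lookE // gh; case: (x g).
- by rewrite /= sz.
- by move=> i; rewrite /= inE => /orP[/eqP->|/sub].
Qed.

Lemma next_testP h : consistent h ->
  ~~ has (satisfied h) f -> has (fun t => ~~ falsified h t) f ->
  exists i t m, [/\ next_test f C h = Some i, i \notin unzip1 h,
    cheapest f C h = Some t &
    (i \in t /\ size f * term_cost C t <= cost (run m)) \/
    (i \in unzip1 (run m) /\ cost (run m) < size f * term_cost C t)].
Proof.
move=> ch /hasPn ns /hasP[t tf nft].
have ut : untested h t by have := ns t tf; rewrite /satisfied nft /= negbK.
have := cheapestP h; rewrite /next_test.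
case: cheapest => [t1 [t1f ut1 mint]|/(_ t tf)]; last first.
  by rewrite ut.
have := untestedP t1 ch; case: untested ut1 => // i1 _ [i1t i1h].
have := searchP (size f * term_cost C t1) i1 n ch tf nft ut.
case: search => [i [m [[-> le]|[im ih lt]]]|[h0 K] [-> _ sz sub]].
- by exists i1, t1, m; split=> //; left.
- by exists i, t1, m; split=> //; right.
(* After [n] iterations without a choice, the simulation would have tested all [n] variables, all of
   them in [h], although [i1] is untested. *)
have : i1 \in unzip1 (run n).
  have := card_uniqP (run_uniq n); rewrite size_map sz -[RHS]card_ord => /eqP card.
  have/subset_leqif_card := subset_predT (mem (unzip1 (run n))).
  by case=> _; rewrite card => /esym/subsetP; apply.
by move/sub; rewrite (negbTE i1h).
Qed.

End Knowledge.

(** * Cost of the interleaved strategy on a fixed assignment *)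

Section Histories.

Variables (n : nat) (f : mdnf n) (C : 'I_n -> nat).
Implicit Types (h : history n) (t : seq 'I_n) (i : 'I_n) (x : assignment n).

Let S := strat f C.

Lemma stratP h x : consistent x h ->
  match S h with
  | Test i => [/\ ~~ has (satisfied h) f, has (fun t => ~~ falsified h t) f &
                  next_test f C h = Some i]
  | Output v => is_cert f v (known h)
  end.
Proof.
move=> ch; rewrite /S /strat; case: ifPn => [sat|ns]; first by rewrite (is_cert_true f ch).
case: ifPn => [op|nop]; last by rewrite (is_cert_false f ch).
by have [i [t [m [-> _ _ _]]]] := next_testP C ch ns op.
Qed.

Lemma hist_consistent x m : consistent x (hist S x m) /\ uniq (unzip1 (hist S x m)).
Proof.
elim: m => //= m [ch uh]; have := stratP ch; case: (S _) => // i [ns op E].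
have [j [t [k []]]] := next_testP C ch ns op; rewrite E => -[<-] ih _ _.
rewrite /consistent all_rcons /= eqxx; split=> //.
by rewrite /unzip1 map_rcons rcons_uniq ih.
Qed.

Lemma strat_evaluates : evaluates S f.
Proof.
move=> x m /=; have [ch uh] := hist_consistent x m.
have := stratP ch; case: (S _) => // i [ns op E].
have [j [t [k []]]] := next_testP C ch ns op; rewrite E => -[<-] -> _ _ /=.
by rewrite (is_cert_true f ch) (is_cert_false f ch) negb_or ns op.
Qed.

(* Each test is paid either by the terms of cost at most [X / size f] or by the
   greedy run, truncated when its cost exceeds [X]. *)
Lemma hist_cost_leq x X :
  (forall h t m, consistent x h -> ~~ has (satisfied h) f ->
     has (fun t => ~~ falsified h t) f -> cheapest f C h = Some t ->
     (size f * term_cost C t <= cost C (run f C x m) -> size f * term_cost C t <= X) /\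
     (cost C (run f C x m) < size f * term_cost C t -> cost C (run f C x m) <= X)) ->
  forall m, cost C (hist S x m) <= 2 * X.
Proof.
move=> HX m.
pose good := [pred i | has (fun t => (i \in t) && (size f * term_cost C t <= X)) f].
(* Invariant: every tested variable lies in a cheap term or in a prefix of the greedy run of cost at
   most [X]. *)
have [j [costj sub]] : exists j, cost C (run f C x j) <= X /\
    forall i, i \in unzip1 (hist S x m) -> good i || (i \in unzip1 (run f C x j)).
  elim: m => [|m [j [costj sub]]].
    by exists 0; rewrite /cost big_nil.
  have [ch uh] := hist_consistent x m.
  rewrite /=; have := stratP ch; case: (S _) => [i [ns op E]|v _]; last by exists j.
  have [i' [t [k []]]] := next_testP C ch ns op; rewrite E => -[<-] ih Et.
  have tf : t \in f by have := cheapestP f C (hist S x m); rewrite Et => -[].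
  have [H1 H2] := HX _ t k ch ns op Et.
  case=> [[it le]|[ik lt]].
    exists j; split=> // u; rewrite /unzip1 map_rcons mem_rcons inE.
    case/orP=> [/eqP->|/sub //]; apply/orP; left; apply/hasP; exists t => //=.
    by rewrite it H1.
  have run_sub a b : a <= b -> {subset unzip1 (run f C x a) <= unzip1 (run f C x b)}.
    by move=> /(run_leq f C x)[s ->] u; rewrite /unzip1 map_cat mem_cat orbC => ->.
  (* Prefixes are nested and both cost at most [X], so the longer one serves. *)
  exists (maxn j k); split; first by case: (leqP j k) => _; [exact: H2 | ].
  move=> u; rewrite /unzip1 map_rcons mem_rcons in_cons => /orP[/eqP->|].
    by apply/orP; right; apply: run_sub ik; rewrite leq_maxr.
  case/sub/orP=> [gu|uj]; apply/orP; first by left.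
  by right; apply: run_sub uj; rewrite leq_maxl.
have [ch uh] := hist_consistent x m.
have costE h : uniq (unzip1 h) -> cost C h = \sum_(i | i \in unzip1 h) C i.
  by move=> u; rewrite -big_uniq // big_map.
have le_union : cost C (hist S x m) <=
    \sum_(i | good i) C i + cost C (run f C x j).
  rewrite (costE _ uh) (costE _ (run_uniq f C x j)) (big_mkcond good).
  rewrite (big_mkcond (fun i => i \in unzip1 (run _ _ _ _))) -big_split /= big_mkcond /=.
  apply: leq_sum => i _; case: ifP => // /sub /orP[] /= ->; rewrite ?leq_addr ?leq_addl //.
apply: (leq_trans le_union); rewrite mul2n -addnn leq_add //.
have le_good : \sum_(i | good i) C i <=
    \sum_(t <- f | size f * term_cost C t <= X) term_cost C t.
  rewrite /term_cost; under [X in _ <= X]eq_bigr => t _ do rewrite big_enum_cond big_mkcond.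
  rewrite exchange_big big_mkcond leq_sum // => i _; case: ifP => // /hasP[t tf /andP[it le]].
  by rewrite (big_rem t) //= le it leq_addr.
apply: (leq_trans le_good); case: (posnP (size f)) => [/size0nil->|f0].
  by rewrite big_nil.
(* Multiplied by [size f], each of the at most [size f] cheap terms contributes at most [X]. *)
rewrite -(leq_pmul2l f0) big_distrr /= -[in X in _ <= X]sum1_size big_distrl /=.
rewrite big_mkcond leq_sum // => t _; rewrite mul1n; case: ifP => //.
Qed.

(** Take for [X] the cost of the complete greedy run, which bounds that of each prefix. *)
Lemma hist_cost_false x m : ~~ eval_mdnf f x ->
  cost C (hist S x m) <= 2 * cost C (run f C x n).
Proof.
move=> fx; apply: hist_cost_leq => h t k _ _ _ _.
have le : cost C (run f C x k) <= cost C (run f C x n).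
  by have [s ->] := run_final f C x k; rewrite /cost big_cat leq_addl.
by split=> // /leq_trans; apply.
Qed.

(** A term true under [x] is never falsified, so until the strategy stops it has an untested
    variable and bounds the cost of the cheapest such term. *)
Lemma hist_cost_true x m t : t \in f -> all x t ->
  cost C (hist S x m) <= 2 * (size f * term_cost C t).
Proof.
move=> tf xt; apply: hist_cost_leq => h u k ch /hasPn ns _ Eu.
have nft : ~~ falsified h t by apply: contraL xt => /(falsified_eval ch).
have ut : untested h t by have := ns t tf; rewrite /satisfied nft /= negbK.
have := cheapestP f C h; rewrite Eu => -[_ _ /(_ t tf ut)] le.
have le' : size f * term_cost C u <= size f * term_cost C t by rewrite leq_mul2l le orbT.
by split=> // /ltnW /leq_trans; apply.
Qed.

End Histories.

(** * Structure of optimal certificates *)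

Section Certificates.

Local Open Scope ring_scope.

Variables (n : nat) (f : mdnf n) (c : 'I_n -> rat).
Hypothesis c_ge0 : forall i, 0 <= c i.
Implicit Types (x : assignment n) (b : partial_assignment n).

(** A certificate contained in [x] can only certify the value at [x]. *)
Lemma CERT_attained x : exists b,
  [/\ is_cert f (eval_mdnf f x) b, contains x b & CERT c f x = cert_cost c b].
Proof.
rewrite /CERT; case: Order.TotalTheory.arg_minP => [|b /andP[cert xb] _].
  have cx : contains x [ffun i => Some (x i)].
    by apply/forallP => i; rewrite ffunE eqxx implybT.
  rewrite cx andbT -[_ || _]/(_ || _).
  have cert : is_cert f (eval_mdnf f x) [ffun i => Some (x i)].
    apply/forallP => y; apply/implyP => /forallP yx.
    suff -> : y = x by [].
    by apply/ffunP => i; have := yx i; rewrite ffunE /= => /eqP[].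
  by move: cert; case: (eval_mdnf f x) => ->; rewrite ?orbT.
exists b; split=> //; case/orP: cert => cert.
  by have := forallP cert x; rewrite xb /= => /eqP->.
by have := forallP cert x; rewrite xb /= => /eqP->.
Qed.

(** Reading [*] as 0 keeps the value 1, so some term lies entirely among the variables that an
    optimal certificate fixes to 1. *)
Lemma CERT_true x : eval_mdnf f x ->
  exists t, [/\ t \in f, all x t & \sum_(i < n | i \in t) c i <= CERT c f x].
Proof.
move=> fx; have [b [cert xb ->]] := CERT_attained x; rewrite fx in cert.
pose y : assignment n := [ffun i => b i == Some true].
have := forallP cert y; have -> : contains y b.
  apply/forallP => i; apply/implyP; rewrite ffunE.
  by case: (b i) => [[]|].
move=> /eqP/hasP[t tf yt]; exists t; split=> //.
  apply: sub_all yt => i; rewrite ffunE => /eqP bi.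
  by have := forallP xb i; rewrite bi /= => /eqP[<-].
rewrite /cert_cost big_mkcond [X in _ <= X]big_mkcond ler_sum // => i _.
case: ifP => [it|_]; last by case: ifP.
by have := allP yt i it; rewrite ffunE => /eqP ->.
Qed.

(** Reading [*] as 1 keeps the value 0, so the variables fixed to 0 hit every term: they form the
    set cover against which the greedy run is measured. *)
Lemma CERT_false x : ~~ eval_mdnf f x ->
  exists S : {set 'I_n}, [/\ forall i, i \in S -> ~~ x i,
    forall t, t \in f -> has (mem S) t & \sum_(i in S) c i <= CERT c f x].
Proof.
move=> fx; have [b [cert xb ->]] := CERT_attained x; rewrite (negbTE fx) in cert.
exists [set i | b i == Some false]; split.
- move=> i; rewrite inE => /eqP bi.
  by have := forallP xb i; rewrite bi /= => /eqP[<-].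
- move=> t tf; pose y : assignment n := [ffun i => b i != Some false].
  have := forallP cert y; have -> : contains y b.
    apply/forallP => i; apply/implyP; rewrite ffunE.
    by case: (b i) => [[]|].
  rewrite /= eqbF_neg => /hasPn /(_ t tf) /allPn[i it]; rewrite ffunE negbK => bi.
  by apply/hasP; exists i; rewrite //= inE.
- rewrite /cert_cost big_mkcond [X in _ <= X]big_mkcond ler_sum // => i _.
  by rewrite inE; case: (b i) => [[]|] //=.
Qed.

Lemma CERT_ge0 x : 0 <= CERT c f x.
Proof.
by have [b [_ _ ->]] := CERT_attained x; apply: sumr_ge0.
Qed.

End Certificates.

(** * Expected cost *)

Section GreedyCover.

Local Open Scope ring_scope.

Definition harmonic_sum (m : nat) : rat := \sum_(i < m) i.+1%:R^-1.

(** Each of the last [d] summands is at least the reciprocal of [a]; for [a = 0] the quotient is 0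
    by convention. *)
Lemma harmonic_sum_drop a d : (d <= a)%N ->
  d%:R / a%:R <= harmonic_sum a - harmonic_sum (a - d).
Proof.
move=> le; case: (posnP a) => [a0|a0].
  by move: le; rewrite a0 leqn0 => /eqP->; rewrite subrr mul0r.
rewrite /harmonic_sum -!(big_mkord xpredT (fun i => i.+1%:R^-1 : rat)).
rewrite (big_cat_nat (n := (a - d)%N)) ?leq_subr //= addrAC subrr add0r.
have -> : d%:R / a%:R = \sum_((a - d)%N <= i < a) (a%:R^-1 : rat).
  by rewrite sumr_const_nat subKn // mulr_natl.
apply: ler_sum_nat => i /andP[_ lt].
by rewrite lef_pV2 ?posrE ?ltr0n // ler_nat.
Qed.

Lemma harmonic_sum_le a b : (a <= b)%N -> harmonic_sum a <= harmonic_sum b.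
Proof.
move=> /subnKC <-; rewrite /harmonic_sum big_split_ord /= lerDl sumr_ge0 // => i _.
by rewrite invr_ge0 ler0n.
Qed.

Lemma harmonic_sum_ge0 a : 0 <= harmonic_sum a.
Proof. by apply: sumr_ge0 => i _; rewrite invr_ge0 ler0n. Qed.

Variables (n : nat) (f : mdnf n) (C : 'I_n -> nat) (x : assignment n).
Variable S : {set 'I_n}.
Hypothesis S_false : forall i, i \in S -> ~~ x i.
Hypothesis S_hits : forall t, t \in f -> has (mem S) t.

Definition zero_cost (h : history n) : nat := (\sum_(a <- h | ~~ a.2) C a.1)%N.

(** Bounds the cost of the zero outcomes still to come, charged to the members of the cover [S]. *)
Definition potential (h : history n) : rat :=
  \sum_(j in S) (C j)%:R * harmonic_sum (count_open f h j).

(** An outcome 1 falsifies nothing. An outcome 0 falsifies all open terms containing [g]; each bears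
    an equal share of [C g] and passes it to a member [j] of [S] hitting it. By the greedy choice a
    share is at most the cost of [j] per open term, so [harmonic_sum_drop] pays for it. *)
Lemma potential_step h g : consistent x h -> greedy f C h = Some g ->
  (if x g then 0 else (C g)%:R) + potential ((g, x g) :: h) <= potential h.
Proof.
move=> ch Eg; have := greedyP f C ch; rewrite Eg => -[gh cg0 ming].
have ch' : consistent x ((g, x g) :: h) by rewrite /= eqxx.
have fals' t : falsified ((g, x g) :: h) t = falsified h t || (g \in t) && ~~ x g.
  rewrite !(falsifiedE _ ch') !(falsifiedE _ ch) -has_pred1.
  elim: t => //= i t ->; rewrite inE [i == g]eq_sym.
  by case: eqP => [<-|_] /=; case: (x _); case: (_ \in unzip1 h);
    case: (has _ _); case: (has _ _).
case xg: (x g).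
  rewrite add0r ler_sum // => j _; rewrite ler_wpM2l ?ler0n //.
  apply: harmonic_sum_le; apply: sub_count => t /andP[-> /=].
  by have := fals' t; rewrite xg andbF orbF => ->.
(* The open terms that [j] loses when [g] turns out to be 0. *)
pose d j := count (fun t : seq 'I_n => [&& j \in t, ~~ falsified h t & g \in t]) f.
have d_le j : (d j <= count_open f h j)%N.
  by apply: sub_count => t /= /and3P[-> -> _].
have cnt' j : count_open f ((g, x g) :: h) j = (count_open f h j - d j)%N.
  have -> : count_open f h j = (d j + count_open f ((g, x g) :: h) j)%N.
    rewrite /count_open /d; elim: (f) => //= t l ->; rewrite fals' xg /= andbT.
    by case: (j \in t); case: (falsified h t); case: (g \in t) => /=; lia.
  by rewrite addKn.
rewrite -xg /potential -lerBrDr -sumrB.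
have cover : (count_open f h g <= \sum_(j in S) d j)%N.
  rewrite /d; under eq_bigr => j _ do rewrite -sum1_count big_mkcond.
  rewrite exchange_big /= /count_open -sum1_count big_mkcond /=.
  rewrite big_seq_cond [X in (_ <= X)%N]big_seq_cond leq_sum // => t /andP[tf _].
  case: ifP => // /andP[gt nf]; have /hasP[j jt /= jS] := S_hits tf.
  by rewrite (bigD1 j) //= jt nf gt leq_addr.
have cgR : 0 < (count_open f h g)%:R :> rat by rewrite ltr0n.
have : (C g)%:R <= \sum_(j in S) ((C g)%:R / (count_open f h g)%:R * (d j)%:R) :> rat.
  rewrite -mulr_sumr -natr_sum -mulrA ler_peMr ?ler0n // mulrC.
  by rewrite -(ler_pM2r cgR) mulfVK ?gt_eqF // mul1r ler_nat.
move=> /le_trans; apply; apply: ler_sum => j jS; rewrite -mulrBr cnt'.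
apply: le_trans (ler_wpM2l (ler0n _ _) (harmonic_sum_drop (d_le j))).
have [cj0|cj0] := posnP (count_open f h j).
  by move: (d_le j); rewrite cj0 leqn0 => /eqP->; rewrite !(mul0r, mulr0).
(* A tested [j] in [S] has outcome 0 and leaves no open term, so this [j] is untested and competed
   with [g] in the greedy choice. *)
have jh : j \notin unzip1 h.
  apply: contraL cj0 => jh; rewrite -leqNgt leqn0 -(negbK (_ == _)) -lt0n -has_count.
  apply/hasPn => t tf /=; rewrite negb_and negbK; case jt: (j \in t) => //=.
  by rewrite (falsifiedE _ ch); apply/hasP; exists j; rewrite // jh S_false.
have cjR : 0 < (count_open f h j)%:R :> rat by rewrite ltr0n.
rewrite [X in _ <= X]mulrCA [X in _ <= X]mulrC ler_wpM2r ?ler0n //.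
by rewrite ler_pdivrMr // mulrAC ler_pdivlMr // -!natrM ler_nat ming.
Qed.

(** Telescopes [potential_step]; initially each variable occurs in at most [size f] open terms. *)
Lemma zero_cost_run_leq m :
  (zero_cost (run f C x m))%:R <=
    harmonic_sum (size f) * (\sum_(j in S) (C j)%:R) :> rat.
Proof.
have : (zero_cost (run f C x m))%:R + potential (run f C x m) <= potential [::].
  elim: m => [|m IH] /=; first by rewrite /zero_cost big_nil add0r.
  rewrite /run_step -/(run f C x m); case Eg: greedy => [g|] //.
  apply: le_trans IH.
  apply: le_trans (lerD (lexx _) (potential_step (run_consistent f C x m) Eg)).
  rewrite /zero_cost big_cons /=; case: (x g); first by rewrite add0r.
  by rewrite natrD addrCA addrA.
have pot_ge0 : 0 <= potential (run f C x m).
  by apply: sumr_ge0 => j _; rewrite mulr_ge0 ?ler0n ?harmonic_sum_ge0.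
have : potential [::] <= harmonic_sum (size f) * (\sum_(j in S) (C j)%:R).
  rewrite mulr_sumr ler_sum // => j _; rewrite mulrC ler_wpM2r ?ler0n //.
  exact: harmonic_sum_le (count_size _ _).
by lra.
Qed.

End GreedyCover.

(** * From the tests with outcome 0 to all greedy tests *)

Section Flip.

Local Open Scope ring_scope.

Variables (n : nat) (f : mdnf n) (C : 'I_n -> nat) (p : 'I_n -> rat).
Hypothesis p_bounds : forall i, 0 < p i < 1.
Implicit Types (x : assignment n) (i : 'I_n).

Definition flip i x : assignment n := [ffun j => if j == i then ~~ x i else x j].

Lemma flipK i : involutive (flip i).
Proof.
by move=> x; apply/ffunP => j; rewrite !ffunE eqxx negbK; case: eqP => // ->.
Qed.

Lemma prD_ge0 x : 0 <= prD p x.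
Proof.
apply: prodr_ge0 => i _; have /andP[p0 p1] := p_bounds i.
by case: (x i); rewrite ?subr_ge0 ltW.
Qed.

Lemma prD_flip i x : ~~ x i -> (1 - p i) * prD p (flip i x) = p i * prD p x.
Proof.
move=> xi; rewrite /prD (bigD1 i) //= [in RHS](bigD1 i) //= ffunE eqxx xi (negbTE xi).
rewrite mulrCA; congr (_ * (_ * _)).
by apply: eq_bigr => j /negbTE ji; rewrite ffunE ji.
Qed.

Lemma eval_flip i x : ~~ x i -> ~~ eval_mdnf f (flip i x) -> ~~ eval_mdnf f x.
Proof.
move=> xi; apply: contra => /hasP[t tf xt]; apply/hasP; exists t => //.
apply: sub_all xt => j xj; rewrite ffunE; case: eqP => [ji|//].
by rewrite -ji xj in xi.
Qed.

Lemma run_flip i x m : i \notin unzip1 (run f C x m) ->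
  run f C (flip i x) m = run f C x m.
Proof.
elim: m => //= m IH; rewrite /run_step -/(run f C x m) -/(run f C (flip i x) m).
case Eg: (greedy f C (run f C x m)) => [g|]; last by move/IH=> ->; rewrite Eg.
rewrite /= inE negb_or => /andP[ig /IH ->]; rewrite Eg ffunE.
by rewrite eq_sym (negbTE ig).
Qed.

(** The decision to test [i] is made before its value is seen. *)
Lemma run_flip_mem i x m :
  (i \in unzip1 (run f C (flip i x) m)) = (i \in unzip1 (run f C x m)).
Proof.
case ix: (i \in unzip1 (run f C x m)); last by rewrite run_flip ?ix.
by apply: contraT => ix'; have := run_flip ix'; rewrite flipK => E; rewrite -E ix in ix'.
Qed.

Lemma rho_gt0 : 0 < rho p.
Proof.
rewrite /rho; elim/big_ind: _ => // [a b|i _]; rewrite lt_min; first by move=> -> ->.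
by have /andP[-> p1] := p_bounds i; rewrite subr_gt0.
Qed.

Lemma rho_leq i : rho p <= 1 - p i.
Proof.
apply: (@le_trans _ _ (Num.min (p i) (1 - p i))); last by rewrite ge_min lexx orbT.
rewrite /rho; have := mem_index_enum i; elim: (index_enum _) => //= j s IH.
rewrite inE big_cons ge_min => /orP[/eqP->|/IH le]; first by rewrite lexx.
by rewrite le orbT.
Qed.

(* Whether the greedy run tests [i] does not depend on [x i], and lowering
   [x i] preserves [f x = 0]: given both events, [x i = 0] has probability at
   least [1 - p i]. *)
Lemma rho_tested_leq i m :
  rho p * (\sum_(x | ~~ eval_mdnf f x && (i \in unzip1 (run f C x m))) prD p x)
  <= \sum_(x | [&& ~~ eval_mdnf f x, i \in unzip1 (run f C x m) & ~~ x i]) prD p x.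
Proof.
pose Q x := ~~ eval_mdnf f x && (i \in unzip1 (run f C x m)).
(* Groups each assignment with [x i = 0] with its flip, so that the bound can be proved pair by
   pair. *)
have -> : \sum_(x | ~~ eval_mdnf f x && (i \in unzip1 (run f C x m))) prD p x =
   \sum_(x : assignment n | ~~ x i)
     ((if Q x then prD p x else 0) + (if Q (flip i x) then prD p (flip i x) else 0)).
  rewrite big_split /= -big_mkcondr -[X in _ + X]big_mkcondr /=.
  rewrite (bigID (fun x : assignment n => ~~ x i)) /=; congr (_ + _).
    by apply: eq_bigl => x; rewrite andbC.
  rewrite (reindex_inj (inv_inj (flipK i))) /=; apply: eq_bigl => x.
  by rewrite ffunE eqxx negbK andbC.
rewrite [X in _ <= X](eq_bigl (fun x : assignment n => ~~ x i && Q x)); last first.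
  by move=> x; rewrite /Q [RHS]andbC -andbA.
rewrite [X in _ <= X]big_mkcondr mulr_sumr; apply: ler_sum => x xi.
have Qflip : Q (flip i x) -> Q x.
  by rewrite /Q run_flip_mem => /andP[/(eval_flip xi) -> ->].
case Qx: (Q x); last first.
  by case: ifP => [/Qflip|_]; rewrite ?Qx // addr0 mulr0.
have /andP[p0 p1] := p_bounds i.
(* Within a pair, the assignment with [x i = 0] carries the fraction [1 - p i] of the
   probability. *)
have le : rho p * (prD p x + prD p (flip i x)) <= prD p x.
  apply: (@le_trans _ _ ((1 - p i) * (prD p x + prD p (flip i x)))).
    by rewrite ler_wpM2r ?rho_leq // addr_ge0 ?prD_ge0.
  by rewrite mulrDr prD_flip // -mulrDl subrK mul1r.
apply: le_trans le; rewrite ler_wpM2l ?(ltW rho_gt0) // lerD2l.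
by case: ifP => // _; apply: prD_ge0.
Qed.

(** Linearity of expectation reduces the claim to [rho_tested_leq] for each variable. *)
Lemma cost_run_expected_leq :
  rho p * (\sum_(x | ~~ eval_mdnf f x) prD p x * (cost C (run f C x n))%:R)
  <= \sum_(x | ~~ eval_mdnf f x) prD p x * (zero_cost C (run f C x n))%:R.
Proof.
have costE x : cost C (run f C x n) =
    (\sum_i (i \in unzip1 (run f C x n)) * C i)%N.
  rewrite /cost -(big_map fst xpredT C) big_uniq ?run_uniq //= big_mkcond.
  by apply: eq_bigr => i _; case: (i \in _); rewrite ?mul1n.
have zeroE x : zero_cost C (run f C x n) =
    (\sum_i ((i \in unzip1 (run f C x n)) && ~~ x i) * C i)%N.
  have -> : zero_cost C (run f C x n) = (\sum_(i <- unzip1 (run f C x n) | ~~ x i) C i)%N.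
    rewrite /zero_cost big_map [LHS]big_seq_cond [RHS]big_seq_cond; apply: eq_bigl => a.
    by case ar: (a \in _) => //=; rewrite (eqP (allP (run_consistent f C x n) _ ar)).
  rewrite big_mkcond big_uniq ?run_uniq //= big_mkcond.
  by apply: eq_bigr => i _; case: (i \in _); case: (x i); rewrite ?mul1n.
have swap (Q : 'I_n -> pred (assignment n)) (F : assignment n -> nat) :
    (forall x, F x = (\sum_i Q i x * C i)%N) ->
    \sum_(x | ~~ eval_mdnf f x) prD p x * (F x)%:R =
    \sum_i (C i)%:R * \sum_(x | ~~ eval_mdnf f x && Q i x) prD p x.
  move=> FE; under eq_bigr => x _ do rewrite FE natr_sum mulr_sumr.
  rewrite exchange_big /=; apply: eq_bigr => i _; rewrite mulr_sumr big_mkcondr /=.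
  by apply: eq_bigr => x _; case: (Q i x); rewrite ?mul1n ?mul0n ?mulr0 // mulrC.
rewrite (swap _ _ costE) (swap _ _ zeroE) mulr_sumr ler_sum // => i _.
by rewrite mulrCA ler_wpM2l ?ler0n ?rho_tested_leq.
Qed.

End Flip.

(** * Assembling the approximation bound *)

Local Open Scope ring_scope.

(** By induction: [ln (1 + y) <= y] at the negative reciprocal of [k + 2] bounds the new summand by
    [ln (k + 2) - ln (k + 1)]. *)
Lemma ratr_harmonic_sum_leq (R : realType) (k : nat) :
  (0 < k)%N -> ratr (harmonic_sum k) <= 1 + ln (k%:R : R).
Proof.
case: k => // k _; elim: k => [|k IH].
  by rewrite /harmonic_sum big_ord1 invr1 rmorph1 ln1 addr0.
rewrite /harmonic_sum big_ord_recr /= -/(harmonic_sum k.+1) rmorphD /= fmorphV rmorph_nat.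
have k1 : 0 < k.+1%:R :> R by rewrite ltr0n.
have k2 : 0 < k.+2%:R :> R by rewrite ltr0n.
have frac : 1 + - k.+2%:R^-1 = k.+1%:R / k.+2%:R :> R.
  have -> : k.+1%:R = k.+2%:R - 1 :> R by rewrite -[k.+2%:R]natr1 addrK.
  by rewrite mulrBl divff ?gt_eqF // mul1r.
have := @le_ln1Dx R (- k.+2%:R^-1).
rewrite frac ln_div ?posrE // => le.
have : - 1 < - k.+2%:R^-1 :> R by rewrite ltrN2 invf_lt1 // ltr1n.
move=> /le; rewrite lerBlDr addrC => {}le.
apply: le_trans (lerD IH (lexx _)) _; by rewrite -addrA lerD2l -lerBrDr.
Qed.

Section Bound.

Variables (n : nat) (f : mdnf n) (p c : 'I_n -> rat).
Hypothesis p_bounds : forall i, 0 < p i < 1.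
Hypothesis c_ge0 : forall i, 0 <= c i.

Let C := scaled_cost c.
Let D : rat := (common_den c)%:R.

Let D_gt0 : 0 < D.
Proof. by rewrite ltr0n common_den_gt0. Qed.

Let hist_cost x : (cost C (hist (strat f C) x n))%:R = D * test_cost c (strat f C) x.
Proof.
rewrite /cost /test_cost natr_sum mulr_sumr; apply: eq_bigr => a _.
exact: scaled_costE.
Qed.

Let term_costE t : (term_cost C t)%:R = D * \sum_(i < n | i \in t) c i.
Proof.
rewrite /term_cost big_enum_cond natr_sum mulr_sumr.
by apply: eq_bigr => i _; exact: scaled_costE.
Qed.

Lemma test_cost_true x : eval_mdnf f x ->
  test_cost c (strat f C) x <= 2 * (size f)%:R * CERT c f x.
Proof.
move=> fx; have [t [tf xt le]] := CERT_true c_ge0 fx.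
rewrite -(ler_pM2l D_gt0) -hist_cost.
have := hist_cost_true C n tf xt; rewrite -(ler_nat rat) => /le_trans; apply.
rewrite !natrM term_costE mulrA [X in X <= _]mulrCA ler_wpM2l ?(ltW D_gt0) //.
by rewrite ler_wpM2l // mulr_ge0 ?ler0n.
Qed.

Lemma zero_cost_leq x : ~~ eval_mdnf f x ->
  (zero_cost C (run f C x n))%:R <= harmonic_sum (size f) * (D * CERT c f x).
Proof.
move=> fx; have [S [S0 hits le]] := CERT_false c_ge0 fx.
apply: le_trans (zero_cost_run_leq C S0 hits n) _.
rewrite ler_wpM2l ?harmonic_sum_ge0 //.
under eq_bigr => i _ do rewrite scaled_costE //.
by rewrite -mulr_sumr ler_wpM2l // ltW.
Qed.

Lemma expectation_leq :
  expectation p (test_cost c (strat f C)) <=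
    2 * (size f)%:R * (\sum_(x | eval_mdnf f x) prD p x * CERT c f x) +
    2 / rho p * harmonic_sum (size f) *
      (\sum_(x | ~~ eval_mdnf f x) prD p x * CERT c f x).
Proof.
rewrite /expectation (bigID (eval_mdnf f)) /=; apply: lerD.
  rewrite mulr_sumr; apply: ler_sum => x fx; rewrite mulrCA.
  by rewrite ler_wpM2l ?prD_ge0 ?test_cost_true.
have rho0 := rho_gt0 p_bounds.
(* Multiplying by [D] gives the integer costs of [hist_cost_false]; multiplying by [rho p] prepares
   [cost_run_expected_leq]. *)
rewrite -(ler_pM2l D_gt0) -(ler_pM2l rho0).
apply: (@le_trans _ _ (2 * (rho p *
    \sum_(x | ~~ eval_mdnf f x) prD p x * (cost C (run f C x n))%:R))).
  rewrite [X in _ <= X]mulrCA ler_pM2l // mulr_sumr [X in _ <= X]mulr_sumr.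
  apply: ler_sum => x fx; rewrite mulrCA -hist_cost [X in _ <= X]mulrCA.
  rewrite ler_wpM2l ?prD_ge0 // -natrM ler_nat.
  exact: hist_cost_false.
have -> : rho p * (D * (2 / rho p * harmonic_sum (size f) *
      (\sum_(x | ~~ eval_mdnf f x) prD p x * CERT c f x))) =
    2 * (\sum_(x | ~~ eval_mdnf f x)
           prD p x * (harmonic_sum (size f) * (D * CERT c f x))).
  under [in RHS]eq_bigr => x _ do rewrite mulrCA [prD p x * _]mulrCA.
  by rewrite -!mulr_sumr; field; rewrite gt_eqF.
rewrite ler_pM2l //; apply: le_trans (cost_run_expected_leq f C p_bounds) _.
by apply: ler_sum => x fx; rewrite ler_wpM2l ?prD_ge0 ?zero_cost_leq.
Qed.

End Bound.

Theorem theorem3 :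
  exists (P : program) (q : {poly nat}),
    forall (R : realType) (n k : nat) (f : mdnf n) (p c : 'I_n -> rat),
      (0 < k)%N ->
      (size f <= k)%N ->
      (forall i, 0 < p i < 1) ->
      (forall i, 0 <= c i) ->
      exists S : strategy n,
        [/\ evaluates S f,
            computes_strategy P f p c S q.[vsize (enc_instance f p c)] &
            (ratr (expectation p (test_cost c S)) : R) <=
              Num.max (2 * k%:R) (2 / ratr (rho p) * (1 + ln k%:R))
              * ratr (expectation p (CERT c f))].
Proof.
have [q Hq] := program_cost_poly; exists prog, q => R n k f p c k0 fk Hp Hc.
exists (strat f (scaled_cost c)); split; first exact: strat_evaluates.
- move=> x m /=; have [ch uh] := hist_consistent f (scaled_cost c) x m.
  have [||t le H] :=
    program_correct p (c := c) (h := hist (strat f (scaled_cost c)) x m) (f := f).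
  + exact: uniq_size_leq.
  + by move=> ns op; have [i [t [j [-> _ _ _]]]] := next_testP (scaled_cost c) ch ns op.
  by exists t => //; apply: leq_trans le (Hq _).
have := expectation_leq f Hp Hc; rewrite -(ler_rat R) => /le_trans; apply.
rewrite [expectation p (CERT c f)](bigID (eval_mdnf f)) /=.
set A := \sum_(x | eval_mdnf f x) _; set B := \sum_(x | ~~ _) _.
have A0 : 0 <= ratr A :> R.
  by rewrite ler0q sumr_ge0 // => x _; rewrite mulr_ge0 ?prD_ge0 ?CERT_ge0.
have B0 : 0 <= ratr B :> R.
  by rewrite ler0q sumr_ge0 // => x _; rewrite mulr_ge0 ?prD_ge0 ?CERT_ge0.
have r0 : 0 < ratr (rho p) :> R by rewrite ltr0q rho_gt0.
(* Assignments of value 1 use the first argument of the maximum, those of value 0 the second. *)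
rewrite !rmorphD /= mulrDr !rmorphM /= fmorphV !rmorph_nat; apply: lerD.
  rewrite ler_wpM2r // le_max; apply/orP; left.
  by rewrite ler_wpM2l // ler_nat.
rewrite ler_wpM2r // le_max; apply/orP; right.
apply: ler_wpM2l; first by apply: divr_ge0 => //; exact: ltW.
apply: (le_trans _ (ratr_harmonic_sum_leq R k0)).
by rewrite ler_rat harmonic_sum_le.
Qed.
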